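(* A piecewise hereditary algebra has no nonzero oriented cycles.
   Context: $\Bbbk$ is an algebraically closed field. All algebras are basic, connected, nonzero, finite-dimensional $\Bbbk$-algebras. An algebra $A$ is piecewise hereditary if it is derived equivalent to a hereditary algebra $H$. An algebra $A$ has no nonzero oriented cycles if $eAe=\Bbbk$ (i.e. $eAe\cong\Bbbk$) for all primitive idempotents $e$ of $A$. *)

(* Defs.v *)
From HB Require Import structures.
From mathcomp Require Import all_boot all_order all_algebra all_field.
From mathcomp Require Import zify.

Set Implicit Arguments.
Unset Strict Implicit.
Unset Printing Implicit Defensive.

Import GRing.Theory.
Local Open Scope ring_scope.
Local Obligation Tactic := idtac.

(* Conventions.  An algebra is a [falgType k]: finite-dimensional, unital,
   nonzero.  mod A is the category of finite-dimensional left modules, i.e. of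
   finite-dimensional k-spaces M with a k-algebra map A -> End_k(M).
   Complexes are cohomological. *)

Lemma linfunK (k : fieldType) (U V : vectType k) (f : U -> V) :
  linear f -> linfun f =1 f.
Proof.
move=> lf; pose F := GRing.isLinear.Build k U V *:%R f lf.
pose g : {linear U -> V} := HB.pack f F.
by move=> x; rewrite (lfunE g).
Qed.

(** * Modules *)

Record fdmod (k : fieldType) (A : falgType k) := FdMod {
  mcar :> vectType k;
  mact : A -> 'End(mcar);
  mact_linear : linear mact;
  mact1 : mact 1 = \1%VF;
  mactM : forall a b, mact (a * b) = (mact a \o mact b)%VF }.

HB.instance Definition _ (k : fieldType) (A : falgType k) (M : fdmod A) :=
  GRing.isLinear.Build k A 'End(M) *:%R (mact M) (mact_linear M).

Section Modules.
Variables (k : fieldType) (A : falgType k).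

Definition modhom (M N : fdmod A) (f : 'Hom(M, N)) :=
  forall a x, f (mact M a x) = mact N a (f x).

Definition modiso (M N : fdmod A) :=
  exists2 f : 'Hom(M, N), modhom f & bijective f.

Definition projective (P : fdmod A) :=
  forall (M N : fdmod A) (g : 'Hom(M, N)) (f : 'Hom(P, N)),
    modhom g -> modhom f -> limg g = fullv ->
    exists2 h : 'Hom(P, M), modhom h & (g \o h)%VF = f.

Definition hereditary :=
  forall (P M : fdmod A) (f : 'Hom(M, P)),
    modhom f -> injective f -> projective P -> projective M.

Section DirectSum.
Variables M N : fdmod A.

Definition dsum_act a : 'End((M * N)%type) :=
  linfun (fun p : (M * N)%type => (mact M a p.1, mact N a p.2)).

Lemma dsum_actE a p : dsum_act a p = (mact M a p.1, mact N a p.2).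
Proof. by apply: linfunK => c x y; rewrite !linearP. Qed.

Fact dsum_act_linear : linear dsum_act.
Proof.
move=> c a b; apply/lfunP => p; rewrite add_lfunE scale_lfunE !dsum_actE.
by rewrite !linearP !add_lfunE !scale_lfunE.
Qed.

Fact dsum_act1 : dsum_act 1 = \1%VF.
Proof.
by apply/lfunP => -[x y]; rewrite dsum_actE !mact1 !id_lfunE.
Qed.

Fact dsum_actM a b : dsum_act (a * b) = (dsum_act a \o dsum_act b)%VF.
Proof. by apply/lfunP => p; rewrite comp_lfunE !dsum_actE !mactM !comp_lfunE. Qed.

Definition dsum : fdmod A := FdMod dsum_act_linear dsum_act1 dsum_actM.

End DirectSum.

(* The left module A e. *)
Section PrincipalModule.
Variable e : A.

Definition lideal : {vspace A} := (fullv * <[e]>)%VS.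

Fact lidealMl a x : x \in lideal -> a * x \in lideal.
Proof.
move=> xU; have: a * x \in (fullv * lideal)%VS by rewrite memv_mul ?memvf.
by rewrite /lideal prodvA; apply: subvP; apply: prodvS; rewrite ?subvf.
Qed.

Definition lideal_act a : 'End(subvs_of lideal) :=
  linfun (fun x => vsproj lideal (a * vsval x)).

Lemma lideal_actE a x : vsval (lideal_act a x) = a * vsval x.
Proof.
rewrite /lideal_act linfunK; first by rewrite vsprojK // lidealMl // subvsP.
by move=> c y z; rewrite linearP /= mulrDr -scalerAr linearP.
Qed.

Fact lideal_act_linear : linear lideal_act.
Proof.
move=> c a b; apply/lfunP => x; apply: val_inj.
rewrite add_lfunE scale_lfunE [LHS]/= !lideal_actE linearP /= !lideal_actE.
by rewrite mulrDl scalerAl.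
Qed.

Fact lideal_act1 : lideal_act 1 = \1%VF.
Proof.
by apply/lfunP => x; apply: val_inj; rewrite /= lideal_actE mul1r id_lfunE.
Qed.

Fact lideal_actM a b : lideal_act (a * b) = (lideal_act a \o lideal_act b)%VF.
Proof.
by apply/lfunP => x; apply: val_inj; rewrite comp_lfunE /= !lideal_actE mulrA.
Qed.

Definition lideal_mod : fdmod A :=
  FdMod lideal_act_linear lideal_act1 lideal_actM.

End PrincipalModule.

(** * Idempotents *)

Definition primitive_idempotent (e : A) :=
  [/\ e != 0, e * e = e &
      forall f g : A, f * f = f -> g * g = g -> f * g = 0 -> g * f = 0 ->
        e = f + g -> f = 0 \/ g = 0].

Definition basic :=
  exists n, exists e : 'I_n -> A,
    [/\ forall i, primitive_idempotent (e i),
        forall i j, i != j -> e i * e j = 0,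
        \sum_i e i = 1 &
        forall i j, i != j -> ~ modiso (lideal_mod (e i)) (lideal_mod (e j))].

Definition connected :=
  ~ exists (B C : falgType k) (f : {lrmorphism A -> (B * C)%type}), bijective f.

Definition corner (e : A) : {vspace A} := (<[e]> * fullv * <[e]>)%VS.

(* For each primitive idempotent e, eAe (with unit e) is isomorphic to k as a
   k-algebra. *)
Definition no_nonzero_oriented_cycles :=
  forall e, primitive_idempotent e ->
    exists phi : {linear k^o -> A},
      [/\ phi 1 = e, forall x y, phi (x * y) = phi x * phi y, injective phi &
          forall a, a \in corner e <-> exists x, phi x = a].

End Modules.

Arguments hereditary {k} A.
Arguments basic {k} A.
Arguments connected {k} A.
Arguments no_nonzero_oriented_cycles {k} A.

(** * Bounded complexes *)

Record cplx (k : fieldType) (A : falgType k) := Cplx {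
  cobj :> int -> fdmod A;
  cdiff : forall i : int, 'Hom(cobj i, cobj (i + 1));
  cdiff_hom : forall i : int, modhom (cdiff i);
  cdiffK : forall (i : int) x, cdiff (i + 1) (cdiff i x) = 0;
  cbounded : exists n : nat, forall i : int,
    (n < `|i|)%N -> \dim (fullv : {vspace cobj i}) = 0%N }.

Record cmap (k : fieldType) (A : falgType k) (X Y : cplx A) := CMap {
  cfun :> forall i : int, 'Hom(X i, Y i);
  cfun_hom : forall i : int, modhom (cfun i);
  cfunD : forall (i : int) x, cfun (i + 1) (cdiff X i x) = cdiff Y i (cfun i x) }.

Section Complexes.
Variables (k : fieldType) (A : falgType k).
Implicit Types X Y Z W : cplx A.

Program Definition cmap_id X : cmap X X := @CMap k A X X (fun i : int => \1%VF) _ _.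
Next Obligation. by move=> X i a x; rewrite !id_lfunE. Qed.
Next Obligation. by move=> X i x; rewrite !id_lfunE. Qed.

Program Definition cmap_comp X Y Z (g : cmap Y Z) (f : cmap X Y) : cmap X Z :=
  @CMap k A X Z (fun i : int => (g i \o f i)%VF) _ _.
Next Obligation. by move=> X Y Z g f i a x; rewrite !comp_lfunE !cfun_hom. Qed.
Next Obligation. by move=> X Y Z g f i x; rewrite !comp_lfunE !cfunD. Qed.

Program Definition cmap_add X Y (f g : cmap X Y) : cmap X Y :=
  @CMap k A X Y (fun i : int => f i + g i) _ _.
Next Obligation.
by move=> X Y f g i a x; rewrite !add_lfunE !cfun_hom linearD.
Qed.
Next Obligation. by move=> X Y f g i x; rewrite !add_lfunE !cfunD linearD. Qed.

Program Definition cmap_scale X Y (c : k) (f : cmap X Y) : cmap X Y :=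
  @CMap k A X Y (fun i : int => c *: f i) _ _.
Next Obligation.
by move=> X Y c f i a x; rewrite !scale_lfunE !cfun_hom linearZ.
Qed.
Next Obligation. by move=> X Y c f i x; rewrite !scale_lfunE !cfunD linearZ. Qed.

(* f - g = d h + h d with h of degree -1.  All degrees are written i + 1, so
   that h^(i+1) : X^(i+1) -> Y^i needs no transport along i - 1 + 1 = i; the
   same device is used in [qis]. *)
Definition homotopic X Y (f g : cmap X Y) :=
  exists2 h : forall i : int, 'Hom(X (i + 1), Y i), forall i : int, modhom (h i) &
    forall (i : int) x, f (i + 1) x - g (i + 1) x
                = cdiff Y i (h i x) + h (i + 1) (cdiff X (i + 1) x).

(* f induces an injection and a surjection on H^(i+1), for every i. *)
Definition qis X Y (f : cmap X Y) :=
  forall i : int,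
    (forall x : X (i + 1), cdiff X (i + 1) x = 0 ->
       (exists y : Y i, f (i + 1) x = cdiff Y i y) ->
       exists x' : X i, x = cdiff X i x') /\
    (forall y : Y (i + 1), cdiff Y (i + 1) y = 0 ->
       exists2 x : X (i + 1), cdiff X (i + 1) x = 0 &
         exists y' : Y i, y - f (i + 1) x = cdiff Y i y').

Lemma qis_id X : qis (cmap_id X).
Proof.
move=> i; split=> [x _ [y]|y dy]; first by rewrite /= id_lfunE; exists y.
by exists y => //; exists 0; rewrite /= id_lfunE subrr linear0.
Qed.

Lemma qis_comp X Y Z (g : cmap Y Z) (f : cmap X Y) :
  qis g -> qis f -> qis (cmap_comp g f).
Proof.
move=> qg qf i; have [gi gs] := qg i; have [fi fs] := qf i; split.
  move=> x dx [z]; rewrite /= comp_lfunE => gfx; apply: fi => //.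
  by apply: gi; [rewrite -cfunD dx linear0 | exists z].
move=> z dz; have [y dy [z' ez]] := gs z dz; have [x dx [y' ey]] := fs y dy.
exists x => //; exists (z' + g i y').
rewrite [RHS](linearD (cdiff Z i)) /= -ez -cfunD -ey comp_lfunE.
by rewrite [g _ (_ - _)]linearB /= addrA subrK.
Qed.

(** ** Shift, direct sum, cone *)

Program Definition cshift X : cplx A :=
  @Cplx k A (fun i : int => X (i + 1)) (fun i : int => - cdiff X (i + 1)) _ _ _.
Next Obligation.
by move=> X i a x; rewrite !opp_lfunE cdiff_hom linearN.
Qed.
Next Obligation.
by move=> X i x; rewrite !opp_lfunE linearN /= cdiffK !oppr0.
Qed.
Next Obligation.
by move=> X; have [n bX] := cbounded X; exists n.+1 => i ni; apply: bX; lia.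
Qed.

Program Definition cmap_shift X Y (f : cmap X Y) : cmap (cshift X) (cshift Y) :=
  @CMap k A (cshift X) (cshift Y) (fun i : int => f (i + 1)) _ _.
Next Obligation. by move=> X Y f i a x; apply: (@cfun_hom _ _ _ _ f (i + 1) a x). Qed.
Next Obligation.
by move=> X Y f i x; rewrite /= !opp_lfunE linearN /= cfunD.
Qed.

Lemma qis_shift X Y (f : cmap X Y) : qis f -> qis (cmap_shift f).
Proof.
move=> qf i; have [fi fs] := qf (i + 1); split.
  move=> x; rewrite /= opp_lfunE => /eqP; rewrite oppr_eq0 => /eqP dx [y].
  rewrite opp_lfunE -linearN => ey; case: (fi x dx); first by exists (- y).
  by move=> x' ->; exists (- x'); rewrite opp_lfunE linearN opprK.
move=> y; rewrite /= opp_lfunE => /eqP; rewrite oppr_eq0 => /eqP dy.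
have [x dx [y' ey]] := fs y dy; exists x; first by rewrite opp_lfunE dx oppr0.
by exists (- y'); rewrite opp_lfunE linearN opprK.
Qed.

Lemma dim_pair0 (U V : vectType k) :
  \dim (fullv : {vspace U}) = 0%N -> \dim (fullv : {vspace V}) = 0%N ->
  \dim (fullv : {vspace (U * V)%type}) = 0%N.
Proof.
move=> /eqP; rewrite dimv_eq0 => /eqP U0 /eqP; rewrite dimv_eq0 => /eqP V0.
apply/eqP; rewrite dimv_eq0 -subv0; apply/subvP => -[u v] _.
have: u \in (0%VS : {vspace U}) by rewrite -U0 memvf.
have: v \in (0%VS : {vspace V}) by rewrite -V0 memvf.
by rewrite !memv0 => /eqP -> /eqP ->.
Qed.

Definition csum_diff X Y (i : int) :
    'Hom(dsum (X i) (Y i), dsum (X (i + 1)) (Y (i + 1))) :=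
  linfun (fun p : (X i * Y i)%type => (cdiff X i p.1, cdiff Y i p.2)).

Lemma csum_diffE X Y i p : csum_diff X Y i p = (cdiff X i p.1, cdiff Y i p.2).
Proof. by apply: linfunK => c x y; rewrite !linearP. Qed.

Program Definition csum X Y : cplx A :=
  @Cplx k A (fun i : int => dsum (X i) (Y i)) (csum_diff X Y) _ _ _.
Next Obligation.
by move=> X Y i a p; rewrite !csum_diffE /= !dsum_actE /= !cdiff_hom.
Qed.
Next Obligation. by move=> X Y i p; rewrite !csum_diffE /= !cdiffK. Qed.
Next Obligation.
move=> X Y; have [m bX] := cbounded X; have [n bY] := cbounded Y.
by exists (m + n)%N => i ni; apply: dim_pair0; [apply: bX | apply: bY]; lia.
Qed.

Definition cpair_fun X Y Z (f : cmap X Y) (g : cmap X Z) (i : int) :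
    'Hom(X i, dsum (Y i) (Z i)) :=
  linfun (fun x => (f i x, g i x) : dsum (Y i) (Z i)).

Lemma cpair_funE X Y Z (f : cmap X Y) (g : cmap X Z) i x :
  cpair_fun f g i x = (f i x, g i x).
Proof. by apply: linfunK => c y z; rewrite !linearP. Qed.

Program Definition cpair X Y Z (f : cmap X Y) (g : cmap X Z) :
    cmap X (csum Y Z) :=
  @CMap k A X (csum Y Z) (cpair_fun f g) _ _.
Next Obligation.
by move=> X Y Z f g i a x; rewrite !cpair_funE /= dsum_actE /= !cfun_hom.
Qed.
Next Obligation.
by move=> X Y Z f g i x; rewrite /= csum_diffE !cpair_funE /= !cfunD.
Qed.

Definition cone_diff X Y (f : cmap X Y) (i : int) :
    'Hom(dsum (X (i + 1)) (Y i), dsum (X (i + 1 + 1)) (Y (i + 1))) :=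
  linfun (fun p : (X (i + 1)%R * Y i)%type =>
            (- cdiff X (i + 1) p.1, f (i + 1) p.1 + cdiff Y i p.2)).

Lemma cone_diffE X Y (f : cmap X Y) i p :
  cone_diff f i p = (- cdiff X (i + 1) p.1, f (i + 1) p.1 + cdiff Y i p.2).
Proof.
apply: linfunK => c x y; rewrite !linearP /=; congr pair.
by rewrite /= scalerDr addrACA.
Qed.

Program Definition cone X Y (f : cmap X Y) : cplx A :=
  @Cplx k A (fun i : int => dsum (X (i + 1)) (Y i)) (cone_diff f) _ _ _.
Next Obligation.
move=> X Y f i a p; rewrite !cone_diffE /= !dsum_actE /= !cdiff_hom !cfun_hom.
by rewrite linearN linearD.
Qed.
Next Obligation.
move=> X Y f i p; rewrite !cone_diffE /=; congr pair.
  by rewrite /= linearN /= cdiffK ?oppr0.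
by rewrite /= !linearN linearD /= cdiffK cfunD addr0 addNr.
Qed.
Next Obligation.
move=> X Y f; have [m bX] := cbounded X; have [n bY] := cbounded Y.
by exists (m + n).+1 => i ni; apply: dim_pair0; [apply: bX | apply: bY]; lia.
Qed.

Definition cone_in_fun X Y (f : cmap X Y) (i : int) : 'Hom(Y i, dsum (X (i + 1)) (Y i)) :=
  linfun (fun y => (0, y) : dsum (X (i + 1)) (Y i)).

Lemma cone_in_funE X Y (f : cmap X Y) i y : cone_in_fun f i y = (0, y).
Proof. by apply: linfunK => c u v; congr pair; rewrite /= scaler0 addr0. Qed.

Program Definition cone_in X Y (f : cmap X Y) : cmap Y (cone f) :=
  @CMap k A Y (cone f) (cone_in_fun f) _ _.
Next Obligation.
by move=> X Y f i a y; rewrite !cone_in_funE /= dsum_actE /= linear0.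
Qed.
Next Obligation.
by move=> X Y f i y; rewrite /= cone_diffE !cone_in_funE /= !linear0 ?oppr0 add0r.
Qed.

Definition cone_out_fun X Y (f : cmap X Y) (i : int) :
    'Hom(dsum (X (i + 1)) (Y i), X (i + 1)) :=
  linfun (fun p : (X (i + 1)%R * Y i)%type => p.1).

Lemma cone_out_funE X Y (f : cmap X Y) i p : cone_out_fun f i p = p.1.
Proof. exact: linfunK. Qed.

Program Definition cone_out X Y (f : cmap X Y) : cmap (cone f) (cshift X) :=
  @CMap k A (cone f) (cshift X) (cone_out_fun f) _ _.
Next Obligation. by move=> X Y f i a p; rewrite !cone_out_funE /= dsum_actE. Qed.
Next Obligation.
by move=> X Y f i p; rewrite /= !cone_out_funE cone_diffE /= opp_lfunE.
Qed.

(** ** Homotopy pushouts *)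

(* The homotopy pushout of Z <-s- Y -g-> W is Cone((s,-g) : Y -> Z (+) W). *)
Definition hopush Y Z W (s : cmap Y Z) (g : cmap Y W) : cplx A :=
  cone (cpair s (cmap_scale (-1) g)).

Definition csum_inl_fun Z W (i : int) : 'Hom(Z i, dsum (Z i) (W i)) :=
  linfun (fun z => (z, 0) : dsum (Z i) (W i)).

Lemma csum_inl_funE Z W i z : csum_inl_fun Z W i z = (z, 0).
Proof. by apply: linfunK => c u v; congr pair; rewrite /= scaler0 addr0. Qed.

Program Definition csum_inl Z W : cmap Z (csum Z W) :=
  @CMap k A Z (csum Z W) (csum_inl_fun Z W) _ _.
Next Obligation.
by move=> Z W i a z; rewrite !csum_inl_funE /= dsum_actE /= linear0.
Qed.
Next Obligation.
by move=> Z W i z; rewrite /= csum_diffE !csum_inl_funE /= linear0.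
Qed.

Definition csum_inr_fun Z W (i : int) : 'Hom(W i, dsum (Z i) (W i)) :=
  linfun (fun w => (0, w) : dsum (Z i) (W i)).

Lemma csum_inr_funE Z W i w : csum_inr_fun Z W i w = (0, w).
Proof. by apply: linfunK => c u v; congr pair; rewrite /= scaler0 addr0. Qed.

Program Definition csum_inr Z W : cmap W (csum Z W) :=
  @CMap k A W (csum Z W) (csum_inr_fun Z W) _ _.
Next Obligation.
by move=> Z W i a w; rewrite !csum_inr_funE /= dsum_actE /= linear0.
Qed.
Next Obligation.
by move=> Z W i w; rewrite /= csum_diffE !csum_inr_funE /= linear0.
Qed.

Definition hopush_inl Y Z W (s : cmap Y Z) (g : cmap Y W) :
  cmap Z (hopush s g) := cmap_comp (cone_in _) (csum_inl Z W).

Definition hopush_inr Y Z W (s : cmap Y Z) (g : cmap Y W) :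
  cmap W (hopush s g) := cmap_comp (cone_in _) (csum_inr Z W).

Lemma hopush_diffE Y Z W (s : cmap Y Z) (g : cmap Y W) i y z w :
  cdiff (hopush s g) i (y, (z, w))
  = (- cdiff Y (i + 1) y,
     (s (i + 1) y + cdiff Z i z, cdiff W i w - g (i + 1) y)).
Proof.
rewrite [LHS]cone_diffE /= csum_diffE cpair_funE /= scale_lfunE scaleN1r.
by congr (_, (_, _)); exact: addrC.
Qed.

Lemma hopush_inlE Y Z W (s : cmap Y Z) (g : cmap Y W) i z :
  hopush_inl s g i z = (0, (z, 0)).
Proof.
rewrite /= comp_lfunE csum_inl_funE.
exact: (@cone_in_funE Y (csum Z W) (cpair s _) i (z, 0)).
Qed.

Lemma hopush_inrE Y Z W (s : cmap Y Z) (g : cmap Y W) i w :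
  hopush_inr s g i w = (0, (0, w)).
Proof.
rewrite /= comp_lfunE csum_inr_funE.
exact: (@cone_in_funE Y (csum Z W) (cpair s _) i (0, w)).
Qed.

Lemma hopush_comm Y Z W (s : cmap Y Z) (g : cmap Y W) :
  homotopic (cmap_comp (hopush_inl s g) s) (cmap_comp (hopush_inr s g) g).
Proof.
pose h i : 'Hom(Y (i + 1), hopush s g i) :=
  linfun (fun y => (y, 0) : (Y (i + 1)%R * (Z i * W i))%type).
have hE i y : h i y = (y, (0, 0)).
  by rewrite /h linfunK // => c u v; congr pair; rewrite /= scaler0 addr0.
exists h => [i a y|i y].
  by rewrite !hE [RHS]dsum_actE; congr pair; rewrite [RHS]dsum_actE /= !linear0.
rewrite !hE hopush_diffE [X in X - _]comp_lfunE [X in _ - X]comp_lfunE.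
rewrite hopush_inlE hopush_inrE.
by congr (_, (_, _)); rewrite /= ?linear0 ?oppr0 ?addr0 ?add0r ?addNr ?subr0.
Qed.

Lemma qis_hopush_inr Y Z W (s : cmap Y Z) (g : cmap Y W) :
  qis s -> qis (hopush_inr s g).
Proof.
move=> qs i; split.
  move=> w dw [[y [z w']]]; rewrite hopush_inrE hopush_diffE.
  case=> /esym/eqP; rewrite oppr_eq0 => /eqP dy ez ew.
  have [] := (qs i).1 y dy.
    exists (- z); rewrite linearN; apply/eqP.
    by rewrite -addr_eq0 -ez.
  move=> y' ey; exists (w' - g i y').
  by rewrite ew ey cfunD linearB.
move=> [y [z w]]; rewrite hopush_diffE.
case=> /eqP; rewrite oppr_eq0 => /eqP dy /eqP sy /eqP gy.
move: sy; rewrite addr_eq0 => /eqP sy.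
move: gy; rewrite subr_eq0 => /eqP gy.
have [y' ey] : exists y' : Y (i + 1), y = cdiff Y (i + 1) y'.
  by apply: (qs (i + 1)).1 => //; exists (- z); rewrite linearN.
have [|y'' dy'' [z' ez']] := (qs i).2 (s (i + 1) y' + z).
  by rewrite linearD /= -cfunD -ey sy addNr.
pose a := y'' - y'.
have da : cdiff Y (i + 1) a = - y by rewrite linearB /= dy'' sub0r ey.
have sa : z = s (i + 1) a + cdiff Z i z'.
  rewrite -ez' linearB /=; move: (s _ y'') (s _ y') => p q.
  by rewrite [q + z]addrC [RHS]addrC addrA subrK addrK.
exists (w + g (i + 1) a).
  by rewrite linearD /= -cfunD da gy linearN subrr.
exists (a, (z', 0)); rewrite hopush_inrE hopush_diffE da opprK -sa.
congr (_, (_, _)); rewrite /= ?subr0 //.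
by rewrite linear0 sub0r opprD addNKr.
Qed.

(** * The bounded derived category *)

(* A morphism X -> Y of D^b(mod A) is represented by a left fraction
   X -f-> Z <-s- Y with s a quasi-isomorphism, up to [frac_eq]. *)
Record frac X Y := Frac {
  fmid : cplx A;
  fnum : cmap X fmid;
  fden : cmap Y fmid;
  fden_qis : qis fden }.

Definition frac_eq X Y (a b : frac X Y) :=
  exists W (u : cmap (fmid a) W) (v : cmap (fmid b) W),
    [/\ qis (cmap_comp u (fden a)),
        homotopic (cmap_comp u (fden a)) (cmap_comp v (fden b)) &
        homotopic (cmap_comp u (fnum a)) (cmap_comp v (fnum b))].

Definition frac_of X Y (f : cmap X Y) : frac X Y := Frac f (qis_id Y).

Definition frac_id X := frac_of (cmap_id X).

Definition frac_comp X Y Z (b : frac Y Z) (a : frac X Y) : frac X Z :=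
  Frac (cmap_comp (hopush_inl (fden a) (fnum b)) (fnum a))
       (qis_comp (qis_hopush_inr (fnum b) (fden_qis a)) (fden_qis b)).

(* Addition reduces a and b to the common denominator given by the homotopy
   pushout of their denominators. *)
Definition frac_add X Y (a b : frac X Y) : frac X Y :=
  Frac (cmap_add (cmap_comp (hopush_inl (fden a) (fden b)) (fnum a))
                 (cmap_comp (hopush_inr (fden a) (fden b)) (fnum b)))
       (qis_comp (qis_hopush_inr (fden b) (fden_qis a)) (fden_qis b)).

Definition frac_scale X Y (c : k) (a : frac X Y) : frac X Y :=
  Frac (cmap_scale c (fnum a)) (fden_qis a).

Definition frac_shift X Y (a : frac X Y) : frac (cshift X) (cshift Y) :=
  Frac (cmap_shift (fnum a)) (qis_shift (fden_qis a)).

Inductive cone_triangle :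
    forall X Y Z, frac X Y -> frac Y Z -> frac Z (cshift X) -> Prop :=
  ConeTriangle X Y (f : cmap X Y) :
    cone_triangle (frac_of f) (frac_of (cone_in f)) (frac_of (cone_out f)).

End Complexes.

(** * Triangle equivalences *)

(* The data of a k-linear triangulated category whose morphisms are given by
   representatives, [teq] being equality of morphisms.  Only the data is
   recorded, since no law is needed to define triangle equivalences.
   Distinguished triangles are those isomorphic to a triangle in [tstd]. *)
Record tricat (k : fieldType) := Tricat {
  tobj :> Type;
  thom : tobj -> tobj -> Type;
  teq : forall X Y, thom X Y -> thom X Y -> Prop;
  tid : forall X, thom X X;
  tcomp : forall X Y Z, thom Y Z -> thom X Y -> thom X Z;
  tadd : forall X Y, thom X Y -> thom X Y -> thom X Y;
  tscale : forall X Y, k -> thom X Y -> thom X Y;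
  tsh : tobj -> tobj;
  tshm : forall X Y, thom X Y -> thom (tsh X) (tsh Y);
  tstd : forall X Y Z, thom X Y -> thom Y Z -> thom Z (tsh X) -> Prop }.

Definition tiso (k : fieldType) (C : tricat k) (X Y : C) (f : thom X Y) :=
  exists g : thom Y X,
    teq (tcomp g f) (tid X) /\ teq (tcomp f g) (tid Y).

Definition distinguished (k : fieldType) (C : tricat k) (X Y Z : C)
    (u : thom X Y) (v : thom Y Z) (w : thom Z (tsh X)) :=
  exists (X' Y' Z' : C) (u' : thom X' Y') (v' : thom Y' Z')
         (w' : thom Z' (tsh X'))
         (a : thom X X') (b : thom Y Y') (c : thom Z Z'),
    tstd u' v' w' /\
    [/\ tiso a, tiso b & tiso c] /\
    [/\ teq (tcomp b u) (tcomp u' a),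
        teq (tcomp c v) (tcomp v' b) &
        teq (tcomp (tshm a) w) (tcomp w' c)].

Record tri_equivalence (k : fieldType) (C D : tricat k) := TriEquivalence {
  eob : C -> D;
  emor : forall X Y : C, thom X Y -> thom (eob X) (eob Y);
  emor_eq : forall (X Y : C) (f g : thom X Y),
    teq f g -> teq (emor f) (emor g);
  emor_id : forall X : C, teq (emor (tid X)) (tid (eob X));
  emor_comp : forall (X Y Z : C) (g : thom Y Z) (f : thom X Y),
    teq (emor (tcomp g f)) (tcomp (emor g) (emor f));
  emor_add : forall (X Y : C) (f g : thom X Y),
    teq (emor (tadd f g)) (tadd (emor f) (emor g));
  emor_scale : forall (X Y : C) (c : k) (f : thom X Y),
    teq (emor (tscale c f)) (tscale c (emor f));
  eshift : forall X : C, thom (eob (tsh X)) (tsh (eob X));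
  eshift_iso : forall X : C, tiso (eshift X);
  eshift_nat : forall (X Y : C) (f : thom X Y),
    teq (tcomp (eshift Y) (emor (tshm f))) (tcomp (tshm (emor f)) (eshift X));
  edist : forall (X Y Z : C) (u : thom X Y) (v : thom Y Z) (w : thom Z (tsh X)),
    distinguished u v w ->
    distinguished (emor u) (emor v) (tcomp (eshift X) (emor w));
  efaithful : forall (X Y : C) (f g : thom X Y),
    teq (emor f) (emor g) -> teq f g;
  efull : forall (X Y : C) (g : thom (eob X) (eob Y)),
    exists f : thom X Y, teq (emor f) g;
  eesssurj : forall Y : D, exists (X : C) (f : thom (eob X) Y), tiso f }.

Definition Db (k : fieldType) (A : falgType k) : tricat k :=
  @Tricat k (cplx A) (@frac k A) (@frac_eq k A) (@frac_id k A)
    (@frac_comp k A) (@frac_add k A) (@frac_scale k A) (@cshift k A)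
    (@frac_shift k A) (@cone_triangle k A).

Definition derived_equivalent (k : fieldType) (A B : falgType k) :=
  inhabited (tri_equivalence (Db A) (Db B)).

Definition piecewise_hereditary (k : fieldType) (A : falgType k) :=
  exists H : falgType k,
    [/\ basic H, connected H, hereditary H & derived_equivalent A H].

(* Main.v *)
Require Import Defs.
From mathcomp Require Import all_boot all_order all_algebra all_field.
From mathcomp Require Import zify.
From Stdlib Require ClassicalEpsilon.

(** Let e be a primitive idempotent of A. Every element of e A e is a scalar
    multiple of e plus a nilpotent (corner_eigenvalue), so e A e consists of
    scalars as soon as it has no nonzero nilpotent (corner_nilpotent_eq0).

    In the derived category e A e is, up to the order of factors, the
    endomorphism ring of A e seen as a complex in one degree (stalk_frac_full,
    rmul_frac_faithful), and Hom(A e, (A e)[1]) = 0 because A e is projective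
    (stalk_frac_ext1). An equivalence with the derived category of a hereditary
    algebra H sends A e to a complex X with the same endomorphism ring and with
    Hom(X, X[1]) = 0.

    As submodules of projective H-modules are projective, X is quasi-isomorphic
    to a direct sum of two-term complexes R i -> P (i + 1) of projectives, one for
    each cohomology module P (i + 1) / R i (reso_qis). Projections to the summands
    are endomorphisms of X, each of which is a scalar plus a nilpotent; so only one
    cohomology module M is nonzero (single_degree). Then endomorphisms of X are
    endomorphisms of M (frac_coh_lift, frac_coh_realize1, frac_coh_faithful), and
    Hom(X, X[1]) = 0 yields Ext^1(M, M) = 0 (frac_ext1).

    It remains to see that a nilpotent endomorphism f of M is zero, which is the
    lemma of Happel and Ringel (rigid_nilpotent_eq0): heredity lifts the extension
    of M / f(M) by f(M) along f, the lift splits over M because Ext^1(M, M) = 0, and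
    the splitting gives endomorphisms a, b of M with f a = (1 - b) f, both of which
    are nilpotent unless f = 0; hence (1 - b)^m f = 0 for some m, and f = 0.

    Fractions are compared through their action on cocycles (frac_coh) wherever
    possible. Degrees are written i + 1 or i + 1 + 1 rather than i - 1, so that no
    element has to be transported along an equation between integers. *)

Set Implicit Arguments.
Unset Strict Implicit.
Unset Printing Implicit Defensive.

Import GRing.Theory.
Local Open Scope ring_scope.

(** * Modules *)

Section LinearMaps.
Variables (k : fieldType) (U V : vectType k).
Implicit Types (f : 'Hom(U, V)) (x y : U).

Lemma homf0 f : f 0 = 0. Proof. exact: linear0. Qed.
Lemma homfD f x y : f (x + y) = f x + f y. Proof. exact: linearD. Qed.
Lemma homfN f x : f (- x) = - f x. Proof. exact: linearN. Qed.
Lemma homfB f x y : f (x - y) = f x - f y. Proof. exact: linearB. Qed.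
Lemma homfZ f c x : f (c *: x) = c *: f x. Proof. exact: linearZ. Qed.

End LinearMaps.

Section ModuleHoms.
Variables (k : fieldType) (A : falgType k).
Implicit Types M N L : fdmod A.

Lemma modhom0 M N : modhom (0 : 'Hom(M, N)).
Proof. by move=> a x; rewrite !zero_lfunE linear0. Qed.

Lemma modhom1 M : modhom (\1%VF : 'End(M)).
Proof. by move=> a x; rewrite !id_lfunE. Qed.

Lemma modhom_comp M N L (g : 'Hom(N, L)) (f : 'Hom(M, N)) :
  modhom g -> modhom f -> modhom (g \o f)%VF.
Proof. by move=> hg hf a x; rewrite !comp_lfunE hf hg. Qed.

Lemma modhomD M N (f g : 'Hom(M, N)) : modhom f -> modhom g -> modhom (f + g).
Proof. by move=> hf hg a x; rewrite !add_lfunE hf hg linearD. Qed.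

Lemma modhomN M N (f : 'Hom(M, N)) : modhom f -> modhom (- f).
Proof. by move=> hf a x; rewrite !opp_lfunE hf linearN. Qed.

Lemma modhomZ M N c (f : 'Hom(M, N)) : modhom f -> modhom (c *: f).
Proof. by move=> hf a x; rewrite !scale_lfunE hf linearZ. Qed.

Lemma modhom_linfun M N (f : M -> N) :
  linear f -> (forall a x, f (mact M a x) = mact N a (f x)) -> modhom (linfun f).
Proof. by move=> lf hf a x; rewrite !linfunK ?hf. Qed.

End ModuleHoms.

Section Submodule.
Variables (k : fieldType) (A : falgType k) (N : fdmod A) (U : {vspace N}).
Hypothesis stU : forall a x, x \in U -> mact N a x \in U.

Definition submod_act a : 'End(subvs_of U) :=
  linfun (fun x => vsproj U (mact N a (vsval x))).

Lemma submod_actE a x : vsval (submod_act a x) = mact N a (vsval x).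
Proof.
rewrite /submod_act linfunK; first by rewrite vsprojK // stU // subvsP.
by move=> c y z; rewrite !linearP.
Qed.

Fact submod_act_linear : linear submod_act.
Proof.
move=> c a b; apply/lfunP => x; apply: val_inj.
rewrite add_lfunE scale_lfunE [RHS]linearP /= !submod_actE.
by rewrite linearP add_lfunE scale_lfunE.
Qed.

Fact submod_act1 : submod_act 1 = \1%VF.
Proof.
by apply/lfunP => x; apply: val_inj; rewrite /= submod_actE mact1 !id_lfunE.
Qed.

Fact submod_actM a b : submod_act (a * b) = (submod_act a \o submod_act b)%VF.
Proof.
apply/lfunP => x; apply: val_inj.
by rewrite comp_lfunE /= !submod_actE mactM comp_lfunE.
Qed.

Definition submod : fdmod A :=
  FdMod submod_act_linear submod_act1 submod_actM.

Definition submod_incl : 'Hom(submod, N) := linfun (@vsval k N U).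

Lemma submod_inclE (x : submod) : submod_incl x = vsval x.
Proof. by rewrite /submod_incl linfunK // => c y z; rewrite linearP. Qed.

Lemma submod_incl_hom : modhom submod_incl.
Proof. by move=> a x; rewrite !submod_inclE submod_actE. Qed.

Lemma submod_incl_inj : injective submod_incl.
Proof. by move=> x y; rewrite !submod_inclE => /val_inj. Qed.

Lemma submod_corestr (M : fdmod A) (f : 'Hom(M, N)) :
    modhom f -> (forall x, f x \in U) ->
  exists2 g : 'Hom(M, submod), modhom g & forall x, vsval (g x) = f x.
Proof.
move=> hf fU; have lg : linear (fun x => vsproj U (f x)).
  by move=> c x y; rewrite !linearP.
exists (linfun (fun x => vsproj U (f x) : submod)); last first.
  by move=> x; rewrite linfunK // vsprojK.
apply: modhom_linfun => // a x; apply: val_inj.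
by rewrite [RHS]submod_actE /= !vsprojK.
Qed.

End Submodule.

Section Projectives.
Variables (k : fieldType) (A : falgType k).
Implicit Types M N P : fdmod A.

(** Projectivity in the form used throughout: g need not be surjective, since it
    can be replaced by its corestriction to its image. *)
Lemma proj_lift P M N (g : 'Hom(M, N)) (f : 'Hom(P, N)) :
    projective P -> modhom g -> modhom f ->
    (forall p, exists m, f p = g m) ->
  exists2 h : 'Hom(P, M), modhom h & forall p, g (h p) = f p.
Proof.
move=> prP hg hf fg; pose U := limg g.
have stU a x : x \in U -> mact N a x \in U.
  by move=> /memv_imgP[m _ ->]; rewrite -hg memv_img ?memvf.
have [g' hg' g'E] := submod_corestr stU hg (fun x => memv_img g (memvf x)).
have fU p : f p \in U by have [m ->] := fg p; rewrite memv_img ?memvf.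
have [f' hf' f'E] := submod_corestr stU hf fU.
have [|h hh ghE] := prP _ _ g' f' hg' hf'.
  apply/vspaceP => y; rewrite memvf; have /memv_imgP[m _ ey] := subvsP y.
  by apply/memv_imgP; exists m; rewrite ?memvf //; apply: val_inj; rewrite [RHS]g'E.
by exists h => // p; rewrite -g'E -f'E -ghE comp_lfunE.
Qed.

Lemma proj_submod P (U : {vspace P}) (stU : forall a x, x \in U -> mact P a x \in U) :
  hereditary A -> projective P -> projective (submod stU).
Proof.
by move=> her; apply: her (@submod_incl_hom _ _ _ _ stU) (@submod_incl_inj _ _ _ _ stU).
Qed.

Section FreeModule.
Variable m : nat.
Let V : vectType k := {ffun 'I_m -> A}.

Definition free_act a : 'End(V) :=
  linfun (fun x : {ffun 'I_m -> A} => [ffun i => a * x i] : V).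

Lemma free_actE a x i : free_act a x i = a * x i.
Proof.
rewrite /free_act linfunK ?ffunE // => c y z.
by apply/ffunP => j; rewrite !ffunE mulrDr scalerAr.
Qed.

Fact free_act_linear : linear free_act.
Proof.
move=> c a b; apply/lfunP => x; apply/ffunP => i.
by rewrite add_lfunE scale_lfunE !ffunE !free_actE mulrDl scalerAl.
Qed.

Fact free_act1 : free_act 1 = \1%VF.
Proof. by apply/lfunP => x; apply/ffunP => i; rewrite free_actE mul1r id_lfunE. Qed.

Fact free_actM a b : free_act (a * b) = (free_act a \o free_act b)%VF.
Proof.
by apply/lfunP => x; apply/ffunP => i; rewrite comp_lfunE !free_actE mulrA.
Qed.

Definition free_mod : fdmod A := FdMod free_act_linear free_act1 free_actM.

Definition free_hom N (v : 'I_m -> N) : 'Hom(free_mod, N) :=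
  linfun (fun x : free_mod => \sum_i mact N ((x : {ffun 'I_m -> A}) i) (v i)).

Lemma free_homE N (v : 'I_m -> N) (x : free_mod) :
  free_hom v x = \sum_i mact N ((x : {ffun 'I_m -> A}) i) (v i).
Proof.
rewrite /free_hom linfunK // => c y z.
rewrite scaler_sumr -big_split /=; apply: eq_bigr => i _.
by rewrite !ffunE linearP add_lfunE scale_lfunE.
Qed.

Lemma free_hom_hom N (v : 'I_m -> N) : modhom (free_hom v).
Proof.
move=> a x; rewrite !free_homE linear_sum; apply: eq_bigr => i _.
by rewrite free_actE mactM comp_lfunE.
Qed.

Definition free_gen i : free_mod := [ffun j => (i == j)%:R : A] : {ffun 'I_m -> A}.

Lemma free_hom_gen N (v : 'I_m -> N) i : free_hom v (free_gen i) = v i.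
Proof.
rewrite free_homE (bigD1 i) //= ffunE eqxx mact1 id_lfunE.
by rewrite big1 ?addr0 // => j /negPf ne; rewrite ffunE eq_sym ne linear0 zero_lfunE.
Qed.

Lemma free_decomp (x : free_mod) :
  x = \sum_i mact free_mod ((x : {ffun 'I_m -> A}) i) (free_gen i).
Proof.
apply/ffunP => j; rewrite sum_ffunE (bigD1 j) //= free_actE ffunE eqxx mulr1.
by rewrite big1 ?addr0 // => i /negPf ne; rewrite free_actE ffunE ne mulr0.
Qed.

Lemma free_projective : projective free_mod.
Proof.
move=> M N g f hg hf sg; exists (free_hom (fun i => (g^-1)%VF (f (free_gen i)))).
  exact: free_hom_hom.
apply/lfunP => x; rewrite comp_lfunE free_homE linear_sum [in RHS](free_decomp x).
rewrite linear_sum; apply: eq_bigr => i _ /=.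
by rewrite hg limg_lfunVK ?sg ?memvf // hf.
Qed.

End FreeModule.

End Projectives.

(** * Rigid modules over a hereditary algebra *)

Lemma iter_scalar (k : fieldType) (V : vectType k) (c : k) m (p : V) :
  iter m (c *: \1%VF : 'End(V)) p = c ^+ m *: p.
Proof.
elim: m => [|m IHm]; first by rewrite scale1r.
by rewrite iterS IHm scale_lfunE id_lfunE exprS scalerA.
Qed.

(** The pair R <= P, with P projective, stands for the module P / R. Its
    endomorphisms are the endomorphisms of P that preserve R, up to those with
    image in R, and Ext^1(P / R, P / R) consists of the maps R -> P / R up to those
    that extend to P. Maps to P / R are represented by maps to P. *)
Section Rigid.
Variables (k : fieldType) (A : falgType k).
Variables (P : fdmod A) (R : {vspace P}).
Hypothesis stR : forall a x, x \in R -> mact P a x \in R.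

(** On the class of a vector that G kills modulo W, the power (G - c)^j is
    (- c)^j. *)
Lemma iter_sub_scalar (W : {vspace P}) (G : 'End(P)) c x j :
    (forall y, y \in W -> G y \in W) -> G x \in W ->
  iter j (G - c *: \1%VF : 'End(P)) x - (- c) ^+ j *: x \in W.
Proof.
move=> GW GxW; elim: j => [|j IHj]; first by rewrite scale1r subrr mem0v.
set y := iter j _ x in IHj *; rewrite iterS -/y exprS -scalerA.
set z := (- c) ^+ j *: x in IHj *.
have -> : (G - c *: \1%VF : 'End(P)) y - - c *: z = G (y - z) + G z - c *: (y - z).
  rewrite add_lfunE opp_lfunE scale_lfunE id_lfunE -linearD subrK.
  by rewrite scaleNr scalerBr opprD !opprK addrA.
have GzW : G z \in W by rewrite linearZ memvZ.
by rewrite memvB ?memvZ // memvD // GW.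
Qed.

Hypothesis her : hereditary A.
Hypothesis prP : projective P.
Hypothesis ext1 : forall phi : 'Hom(submod stR, P), modhom phi ->
  exists2 mu : 'End(P), modhom mu & forall r, phi r - mu (vsval r) \in R.
Hypothesis local_end : forall G : 'End(P),
    modhom G -> (forall x, x \in R -> G x \in R) ->
  exists c j, forall p, iter j (G - c *: \1%VF : 'End(P)) p \in R.

(** An endomorphism of P / R that is not injective, or not surjective, has
    eigenvalue 0, so the local endomorphism ring makes it nilpotent. *)
Lemma nil_of_ker (G : 'End(P)) x :
    modhom G -> (forall y, y \in R -> G y \in R) -> x \notin R -> G x \in R ->
  exists j, forall p, iter j G p \in R.
Proof.
move=> hG GR xR GxR; have [c [j Gj]] := local_end hG GR.
have := iter_sub_scalar c j GR GxR; rewrite rpredBl //.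
rewrite rpredZeq (negPf xR) orbF expf_eq0 oppr_eq0 => /andP[_ /eqP c0].
by exists j => p; have := Gj p; rewrite c0 scale0r subr0.
Qed.

Lemma nil_of_im (G : 'End(P)) (W : {vspace P}) x :
    modhom G -> (forall y, y \in R -> G y \in R) -> (R <= W)%VS ->
    (forall y, G y \in W) -> x \notin W ->
  exists j, forall p, iter j G p \in R.
Proof.
move=> hG GR RW GW xW; have [c [j Gj]] := local_end hG GR.
have := @iter_sub_scalar W G c x j (fun y _ => GW y) (GW x).
rewrite rpredBl; last exact: (subvP RW _ (Gj x)).
rewrite rpredZeq (negPf xW) orbF expf_eq0 oppr_eq0 => /andP[_ /eqP c0].
by exists j => p; have := Gj p; rewrite c0 scale0r subr0.
Qed.

(** The argument of Happel and Ringel. Write M = P / R and f for the map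
    induced by F. The extension of M / f(M) by f(M) with middle term M lifts along
    f : M -> f(M), since W below is projective; the lift is the map lam on W.
    Pulled back to M, the lifted extension is the restriction of lam to R, and it
    splits because Ext^1(M, M) = 0; the splitting is mu. In terms of
    al = (lam - mu) F and be = F mu this says f al = (1 - be) f, where al kills the
    kernel of f and the image of be lies in that of f. If f is nilpotent and
    nonzero then al is not injective and be is not surjective, so both are
    nilpotent, and (1 - be)^m f = f al^m = 0 with 1 - be invertible. *)
Lemma rigid_nilpotent_eq0 (F : 'End(P)) j :
    modhom F -> (forall x, x \in R -> F x \in R) ->
    (forall p, iter j F p \in R) ->
  forall p, F p \in R.
Proof.
move=> hF FR Fj p0; apply/negPn/negP => Fp0R.
pose W := (limg F + R)%VS.
have RW : (R <= W)%VS := addvSr _ _.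
have FW y : F y \in W by rewrite (subvP (addvSl _ R)) ?memv_img ?memvf.
have WP y : y \in W -> exists q, y - F q \in R.
  by move=> /memv_addP[u /memv_imgP[q _ ->] [v vR ->]]; exists q; rewrite addrC addKr.
have stW a y : y \in W -> mact P a y \in W.
  move=> /memv_addP[u /memv_imgP[q _ ->] [v vR ->]]; rewrite linearD /= -hF.
  by rewrite memvD ?FW // (subvP RW) ?stR.
(* f is not surjective, being nilpotent on a nonzero module. *)
have [x0 xW] : exists x0, x0 \notin W.
  apply: Classical_Prop.NNPP => nW.
  have allW y : y \in W by apply/negPn/negP => yW; apply: nW; exists y.
  have onto m y : exists q, y - iter m F q \in R.
    elim: m y => [|m IHm] y; first by exists y; rewrite subrr mem0v.
    have [q yq] := WP _ (allW y); have [q' qq'] := IHm q; exists q'.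
    rewrite iterS -(subrKA (F q)) memvD // -linearB; exact: FR.
  have [q] := onto j (F p0); rewrite rpredBr ?Fj //; exact/negP.
(* f is not injective: the last power of f that is nonzero on F p0. *)
have [x xR FxR] : exists2 x, x \notin R & F x \in R.
  elim: {Fp0R}j {Fj}(F p0) (Fj (F p0)) Fp0R => [|m IHm] y /=; first by move=> ->.
  move=> yR ynR; have [mR|/negP mR] := boolP (iter m F y \in R); first exact: (IHm y).
  by exists (iter m F y) => //; apply/negP.
(* A section over W of the surjection P (+) R -> W given by F and the inclusion
   of R; its first component lam satisfies F lam = 1 modulo R. *)
have [lam [hlam lamE]] : exists lam : 'Hom(submod stW, P),
    modhom lam /\ forall w, F (lam w) - vsval w \in R.
  pose g : 'Hom(dsum P (submod stR), P) :=
    linfun (fun u : (P * submod stR)%type => F u.1 + vsval u.2).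
  have gE u : g u = F u.1 + vsval u.2.
    by apply: linfunK => c y z; rewrite !linearP /= scalerDr addrACA.
  have hg : modhom g.
    by move=> a u; rewrite !gE dsum_actE /= hF (submod_actE stR) linearD.
  have [|h hh hE] := proj_lift (@proj_submod _ _ _ _ stW her prP) hg
                       (@submod_incl_hom _ _ _ _ stW).
    move=> w; rewrite submod_inclE.
    have /memv_addP[u /memv_imgP[q _ ->] [v vR ->]] := subvsP w.
    by exists (q, vsproj R v); rewrite gE /= vsprojK.
  exists (linfun (fun w => (h w).1)).
  have lE : linfun (fun w => (h w).1) =1 (fun w => (h w).1).
    by apply: linfunK => c y z; rewrite linearP.
  split=> [a w|w]; first by rewrite !lE hh dsum_actE.
  by have := hE w; rewrite gE submod_inclE lE => <-; rewrite opprD addNKr memvN subvsP.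
have [i [hi iE]] : exists i : 'Hom(submod stR, submod stW),
    modhom i /\ forall r, vsval (i r) = vsval r.
  have [|i hi iE] := submod_corestr stW (@submod_incl_hom _ _ _ _ stR).
    by move=> r; rewrite submod_inclE (subvP RW) ?subvsP.
  by exists i; split=> // r; rewrite iE submod_inclE.
have [F' hF' F'E] := submod_corestr stW hF FW.
have [mu hmu muE] := ext1 (modhom_comp hlam hi).
have muR r : r \in R -> lam (vsproj W r) - mu r \in R.
  move=> rR; have := muE (vsproj R r); rewrite comp_lfunE vsprojK //.
  suff -> : i (vsproj R r) = vsproj W r by [].
  by apply: val_inj; rewrite [LHS]iE /= !vsprojK // (subvP RW).
pose al : 'End(P) := (lam \o F')%VF - (mu \o F)%VF.
pose be : 'End(P) := (F \o mu)%VF.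
have alE y : al y = lam (vsproj W (F y)) - mu (F y).
  rewrite add_lfunE opp_lfunE !comp_lfunE; congr (lam _ - _).
  by apply: val_inj; rewrite [LHS]F'E /= vsprojK.
have hal : modhom al by apply: modhomD (modhomN _); apply: modhom_comp.
have hbe : modhom be by apply: modhom_comp.
have alR y : F y \in R -> al y \in R by move=> FyR; rewrite alE muR.
have beR y : y \in R -> be y \in R.
  move=> yR; rewrite comp_lfunE -[_ (mu y)](subrK (F (lam (vsproj W y)))).
  rewrite memvD //; first by rewrite -linearB FR // -opprB memvN muR.
  rewrite -[F _](subrK y) memvD //.
  by have := lamE (vsproj W y); rewrite vsprojK // (subvP RW).
have Fal y : F (al y) - (F y - be (F y)) \in R.
  have := lamE (vsproj W (F y)); rewrite vsprojK //.
  by rewrite alE linearB comp_lfunE /= opprB addrA subrK.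
have [m alm] := nil_of_ker hal (fun y yR => alR y (FR y yR)) xR (alR x FxR).
have beW y : be y \in W by rewrite comp_lfunE.
have [m' bem] := nil_of_im hbe beR RW beW xW.
have one_sub_be y : y - be y \in R -> y \in R.
  move=> yR; have : forall n, y - iter n be y \in R.
    elim=> [|n IHn]; first by rewrite subrr mem0v.
    by rewrite iterS -(subrKA (be y)) memvD // -linearB beR.
  by move=> /(_ m'); rewrite rpredBr.
case/negP: Fp0R; have : F (iter m al p0) \in R by rewrite FR.
elim: m {alm} => // m IHm /=; set y := iter m al p0 in IHm *.
by have := Fal y => h1 h2; move: h1; rewrite rpredBl // => /one_sub_be/IHm.
Qed.

End Rigid.

(** * Cohomology classes of cocycles *)

Section Cohomology.
Variables (k : fieldType) (A : falgType k).
Implicit Types X Y Z W : cplx A.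

Definition cohomologous Z (i : int) (x y : Z (i + 1)) :=
  exists w : Z i, x - y = cdiff Z i w.

Lemma coh_refl Z (i : int) (x : Z (i + 1)) : cohomologous x x.
Proof. by exists 0; rewrite subrr homf0. Qed.

Lemma coh_sym Z (i : int) (x y : Z (i + 1)) :
  cohomologous x y -> cohomologous y x.
Proof. by move=> [w e]; exists (- w); rewrite homfN -e opprB. Qed.

Lemma coh_trans Z (i : int) (y x z : Z (i + 1)) :
  cohomologous x y -> cohomologous y z -> cohomologous x z.
Proof.
by move=> [w e] [w' e']; exists (w + w'); rewrite homfD -e -e' subrKA.
Qed.

Lemma cohD Z (i : int) (x y x' y' : Z (i + 1)) :
  cohomologous x y -> cohomologous x' y' -> cohomologous (x + x') (y + y').
Proof.
move=> [w e] [w' e']; exists (w + w').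
by rewrite homfD -e -e' opprD addrACA.
Qed.

Lemma cohZ Z (i : int) c (x y : Z (i + 1)) :
  cohomologous x y -> cohomologous (c *: x) (c *: y).
Proof. by move=> [w e]; exists (c *: w); rewrite homfZ -e scalerBr. Qed.

Lemma coh_map Z W (f : cmap Z W) (i : int) (x y : Z (i + 1)) :
  cohomologous x y -> cohomologous (f (i + 1) x) (f (i + 1) y).
Proof. by move=> [w e]; exists (f i w); rewrite -cfunD -e homfB. Qed.

Lemma coh_act (Z : cplx A) (i : int) a (x y : Z (i + 1)) :
  cohomologous x y -> cohomologous (mact _ a x) (mact _ a y).
Proof. by move=> [w ew]; exists (mact _ a w); rewrite -homfB ew cdiff_hom. Qed.

Lemma coh_homotopic Z W (f g : cmap Z W) (i : int) (x : Z (i + 1)) :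
  homotopic f g -> cdiff Z (i + 1) x = 0 ->
  cohomologous (f (i + 1) x) (g (i + 1) x).
Proof. by move=> [h _ hE] dx; exists (h i x); rewrite hE dx homf0 addr0. Qed.

Lemma cmap_cycle X Y (f : cmap X Y) (i : int) (x : X i) :
  cdiff X i x = 0 -> cdiff Y i (f i x) = 0.
Proof. by move=> dx; rewrite -cfunD dx homf0. Qed.

Lemma cmap_compE X Y Z (g : cmap Y Z) (f : cmap X Y) (i : int) x :
  cmap_comp g f i x = g i (f i x).
Proof. by rewrite /= comp_lfunE. Qed.

Lemma cycleB X (i : int) (x y : X i) :
  cdiff X i x = 0 -> cdiff X i y = 0 -> cdiff X i (x - y) = 0.
Proof. by move=> dx dy; rewrite homfB dx dy subr0. Qed.

Lemma qis_inj X Y (f : cmap X Y) (i : int) (x y : X (i + 1)) :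
  qis f -> cdiff X (i + 1) x = 0 -> cdiff X (i + 1) y = 0 ->
  cohomologous (f (i + 1) x) (f (i + 1) y) -> cohomologous x y.
Proof.
move=> qf dx dy [w e]; have [|w' ew'] := (qf i).1 (x - y) (cycleB dx dy).
  by exists w; rewrite homfB.
by exists w'.
Qed.

Lemma qis_surj X Y (f : cmap X Y) (i : int) (y : Y (i + 1)) :
  qis f -> cdiff Y (i + 1) y = 0 ->
  exists2 x, cdiff X (i + 1) x = 0 & cohomologous y (f (i + 1) x).
Proof. by move=> qf /((qf i).2 y) [x dx [w e]]; exists x => //; exists w. Qed.

Lemma qis_of_coh X Y (f : cmap X Y) :
    (forall (i : int) (x : X (i + 1)), cdiff X (i + 1) x = 0 ->
       cohomologous (f (i + 1) x) 0 -> cohomologous x 0) ->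
    (forall (i : int) (y : Y (i + 1)), cdiff Y (i + 1) y = 0 ->
       exists2 x, cdiff X (i + 1) x = 0 & cohomologous y (f (i + 1) x)) ->
  qis f.
Proof.
move=> fi fs i; split=> [x dx [w e]|y /fs[x dx [w e]]].
  have [|w' ew'] := fi i x dx; first by exists w; rewrite subr0.
  by exists w'; rewrite -ew' subr0.
by exists x => //; exists w.
Qed.

Lemma qis_homotopic X Y (f g : cmap X Y) : homotopic f g -> qis f -> qis g.
Proof.
move=> fg qf; apply: qis_of_coh => i.
  move=> x dx gx0; apply: (qis_inj qf) => //; first by rewrite homf0.
  by rewrite homf0; apply: coh_trans _ gx0; apply: coh_homotopic.
move=> y dy; have [x dx yx] := qis_surj qf dy; exists x => //.
by apply: coh_trans yx _; apply: coh_homotopic.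
Qed.

(** Two out of three, in the only case needed: it turns denominators of composite
    fractions into quasi-isomorphisms of single maps. *)
Lemma qis_cancel X Y Z (g : cmap Y Z) (f : cmap X Y) :
  qis f -> qis (cmap_comp g f) -> qis g.
Proof.
move=> qf qgf; apply: qis_of_coh => i.
  move=> y dy gy0; have [x dx yx] := qis_surj qf dy.
  apply: (coh_trans yx); rewrite -[0](homf0 (f (i + 1))); apply: coh_map.
  apply: (qis_inj qgf) => //; first by rewrite homf0.
  by rewrite homf0 cmap_compE; apply: coh_trans (coh_sym (coh_map g yx)) gy0.
move=> z dz; have [x dx zx] := qis_surj qgf dz.
by exists (f (i + 1) x); [apply: cmap_cycle | rewrite -cmap_compE].
Qed.

Lemma homotopic_ext X Y (f g : cmap X Y) :
  (forall (i : int) x, f (i + 1) x = g (i + 1) x) -> homotopic f g.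
Proof.
move=> fg; exists (fun i => 0) => [i|i x]; first exact: modhom0.
by rewrite fg subrr !zero_lfunE homf0 addr0.
Qed.

Lemma homotopic_sym X Y (f g : cmap X Y) : homotopic f g -> homotopic g f.
Proof.
move=> [h hh hE]; exists (fun i => - h i) => [i|i x]; first exact: modhomN.
by rewrite !opp_lfunE homfN -opprD -hE opprB.
Qed.

Lemma homotopic_trans X Y (g f l : cmap X Y) :
  homotopic f g -> homotopic g l -> homotopic f l.
Proof.
move=> [h hh hE] [h' hh' hE']; exists (fun i => h i + h' i) => [i|i x].
  exact: modhomD.
by rewrite !add_lfunE homfD addrACA -hE -hE' subrKA.
Qed.

Lemma homotopic_compl X Y Z (u : cmap Y Z) (f g : cmap X Y) :
  homotopic f g -> homotopic (cmap_comp u f) (cmap_comp u g).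
Proof.
move=> [h hh hE]; exists (fun i => (u i \o h i)%VF) => [i|i x].
  by apply: modhom_comp => //; apply: cfun_hom.
by rewrite !cmap_compE !comp_lfunE -cfunD -homfB hE homfD.
Qed.

Lemma homotopic_compr X Y Z (u : cmap X Y) (f g : cmap Y Z) :
  homotopic f g -> homotopic (cmap_comp f u) (cmap_comp g u).
Proof.
move=> [h hh hE]; exists (fun i => (h i \o u (i + 1))%VF) => [i|i x].
  by apply: modhom_comp => //; apply: cfun_hom.
by rewrite !cmap_compE !comp_lfunE hE cfunD.
Qed.

Lemma homotopicA X Y Z W (u : cmap Z W) (v : cmap Y Z) (w : cmap X Y) :
  homotopic (cmap_comp (cmap_comp u v) w) (cmap_comp u (cmap_comp v w)).
Proof. by apply: homotopic_ext => i x; rewrite /= !comp_lfunE. Qed.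

Lemma hopush_coh Y Z W (s : cmap Y Z) (g : cmap Y W) (i : int) (y : Y (i + 1)) :
    cdiff Y (i + 1) y = 0 ->
  cohomologous (hopush_inl s g (i + 1) (s (i + 1) y))
               (hopush_inr s g (i + 1) (g (i + 1) y)).
Proof.
move=> dy; have := coh_homotopic (hopush_comm s g) dy.
by rewrite (cmap_compE (hopush_inl _ _)) (cmap_compE (hopush_inr _ _)).
Qed.

(** * Fractions and their action on cohomology *)

(** The action of a left fraction on cohomology, as a relation between cocycles.
    It replaces most identities between fractions: it respects frac_eq,
    composition, addition and scaling, and it needs no common denominators. *)
Definition frac_coh X Y (a : Defs.frac X Y) (i : int) (x : X (i + 1)) (y : Y (i + 1)) :=
  cohomologous (fnum a (i + 1) x) (fden a (i + 1) y).

Section FracCoh.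
Variable i : int.

Lemma frac_coh_total X Y (a : Defs.frac X Y) (x : X (i + 1)) :
  cdiff X (i + 1) x = 0 -> exists2 y, cdiff Y (i + 1) y = 0 & frac_coh a x y.
Proof. by move=> dx; apply: (qis_surj (fden_qis a)); apply: cmap_cycle. Qed.

Lemma frac_coh_uniq X Y (a : Defs.frac X Y) (x : X (i + 1)) y y' :
  cdiff Y (i + 1) y = 0 -> cdiff Y (i + 1) y' = 0 ->
  frac_coh a x y -> frac_coh a x y' -> cohomologous y y'.
Proof.
move=> dy dy' xy xy'; apply: (qis_inj (fden_qis a)) => //.
exact: coh_trans (coh_sym xy) xy'.
Qed.

Lemma frac_coh_eq X Y (a b : Defs.frac X Y) (x : X (i + 1)) y :
  cdiff X (i + 1) x = 0 -> cdiff Y (i + 1) y = 0 ->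
  frac_eq a b -> frac_coh a x y -> frac_coh b x y.
Proof.
move=> dx dy [W [u [v [qua den num]]]] xy.
have qv : qis v.
  by apply: (qis_cancel (fden_qis b)); apply: qis_homotopic den qua.
apply: (qis_inj qv); rewrite ?cmap_cycle //.
have := coh_homotopic den dy; have := coh_homotopic num dx; rewrite !cmap_compE.
move=> nx ny; apply: coh_trans (coh_sym nx) _.
by apply: coh_trans (coh_map _ xy) ny.
Qed.

Lemma frac_eq_sym X Y (a b : Defs.frac X Y) : frac_eq a b -> frac_eq b a.
Proof.
move=> [W [u [v [qua den num]]]]; exists W, v, u.
by split; [apply: qis_homotopic den qua | apply: homotopic_sym..].
Qed.

Lemma frac_coh_comp X Y Z (a : Defs.frac X Y) (b : Defs.frac Y Z)
    (x : X (i + 1)) y z :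
  cdiff Y (i + 1) y = 0 ->
  frac_coh a x y -> frac_coh b y z -> frac_coh (frac_comp b a) x z.
Proof.
move=> dy xy yz.
suff: cohomologous (hopush_inl (fden a) (fnum b) (i + 1) (fnum a (i + 1) x))
                   (hopush_inr (fden a) (fnum b) (i + 1) (fden b (i + 1) z)).
  by rewrite -!cmap_compE.
apply: (coh_trans (coh_map (hopush_inl _ _) xy)); apply: (coh_trans (hopush_coh _ _ dy)).
exact: (coh_map (hopush_inr _ _) yz).
Qed.

Lemma frac_coh_add X Y (a b : Defs.frac X Y) (x : X (i + 1)) y y' :
  cdiff Y (i + 1) y = 0 ->
  frac_coh a x y -> frac_coh b x y' -> frac_coh (frac_add a b) x (y + y').
Proof.
move=> dy xy xy'.
suff: cohomologous (hopush_inl (fden a) (fden b) (i + 1) (fnum a (i + 1) x)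
                    + hopush_inr (fden a) (fden b) (i + 1) (fnum b (i + 1) x))
                   (hopush_inr (fden a) (fden b) (i + 1) (fden b (i + 1) y)
                    + hopush_inr (fden a) (fden b) (i + 1) (fden b (i + 1) y')).
  by rewrite -!homfD -!cmap_compE -add_lfunE.
exact: (cohD (coh_trans (coh_map (hopush_inl _ _) xy) (hopush_coh _ _ dy))
             (coh_map (hopush_inr _ _) xy')).
Qed.

Lemma frac_coh_scale X Y c (a : Defs.frac X Y) (x : X (i + 1)) y :
  frac_coh a x y -> frac_coh (frac_scale c a) x (c *: y).
Proof. by rewrite /frac_coh /= scale_lfunE homfZ; apply: cohZ. Qed.

Lemma frac_coh_of X Y (f : cmap X Y) (x : X (i + 1)) :
  frac_coh (frac_of f) x (f (i + 1) x).
Proof. by rewrite /frac_coh /= id_lfunE; apply: coh_refl. Qed.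

End FracCoh.

Lemma frac_eq_num X Y Z (f g : cmap X Z) (s : cmap Y Z) (qs : qis s) :
  homotopic f g -> frac_eq (Frac f qs) (Frac g qs).
Proof.
move=> fg; exists Z, (cmap_id Z), (cmap_id Z); split=> /=.
- exact: qis_comp (qis_id _) qs.
- exact: homotopic_ext.
- exact: homotopic_compl.
Qed.

Lemma frac_of_comp X Y Z (g : cmap Y Z) (f : cmap X Y) (h : cmap X Z) :
    (forall (i : int) x, h (i + 1) x = g (i + 1) (f (i + 1) x)) ->
  frac_eq (frac_of h) (frac_comp (frac_of g) (frac_of f)).
Proof.
move=> hE; set W := fmid (frac_comp (frac_of g) (frac_of f)).
exists W, (hopush_inr (cmap_id Y) g), (cmap_id W); split.
- exact: qis_comp (qis_hopush_inr _ (qis_id _)) (qis_id _).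
- by apply: homotopic_ext => i x; rewrite /= !comp_lfunE !id_lfunE.
have c := homotopic_sym (homotopic_compr f (hopush_comm (cmap_id Y) g)).
apply: homotopic_trans (homotopic_trans _ c) _; apply: homotopic_ext => i x.
  by rewrite /= !comp_lfunE hE.
by rewrite /= !comp_lfunE !id_lfunE.
Qed.

Lemma frac_of_add X Y (f g h : cmap X Y) :
    (forall (i : int) x, h (i + 1) x = f (i + 1) x + g (i + 1) x) ->
  frac_eq (frac_of h) (frac_add (frac_of f) (frac_of g)).
Proof.
move=> hE; set W := fmid (frac_add (frac_of f) (frac_of g)).
exists W, (hopush_inr (cmap_id Y) (cmap_id Y)), (cmap_id W); split.
- exact: qis_comp (qis_hopush_inr _ (qis_id _)) (qis_id _).
- by apply: homotopic_ext => i x; rewrite /= !comp_lfunE !id_lfunE.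
have [e he eE] := homotopic_compr f (hopush_comm (cmap_id Y) (cmap_id Y)).
apply: homotopic_sym; exists e => // i x; rewrite -eE.
rewrite 2!cmap_compE hE homfD.
rewrite id_lfunE [fnum _ _ _]add_lfunE /= !comp_lfunE !id_lfunE.
by rewrite opprD addrACA subrr addr0.
Qed.

End Cohomology.

(** * Localization at quasi-isomorphisms *)

Section Localization.
Variables (k : fieldType) (A : falgType k).
Implicit Types X Y Z W Q : cplx A.

Lemma cone_acyclic Q X (s : cmap Q X) (i : int) (c : cone s (i + 1)) :
  qis s -> cdiff (cone s) (i + 1) c = 0 -> exists c', c = cdiff (cone s) i c'.
Proof.
case: c => q x qs; rewrite [LHS]cone_diffE => -[] /= /eqP; rewrite oppr_eq0.
move=> /eqP dq /eqP; rewrite addr_eq0 => /eqP sq.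
have [q' eq'] : exists q' : Q (i + 1), q = cdiff Q (i + 1) q'.
  by apply: ((qs (i + 1)).1 q dq); exists (- x); rewrite homfN.
have [|q'' dq'' [w ew]] := (qs i).2 (s (i + 1) q' + x).
  by rewrite homfD -cfunD -eq' sq addNr.
exists ((q'' - q'), w); rewrite [RHS]cone_diffE /= homfB dq'' sub0r opprK -eq'.
by congr pair; rewrite homfB -ew [RHS]addrC subrKA addrAC subrr add0r.
Qed.

Lemma qis_cone_in X Y (f : cmap X Y) :
    (forall (i : int) (x : X (i + 1)), cdiff X (i + 1) x = 0 ->
       exists x', x = cdiff X i x') ->
  qis (cone_in f).
Proof.
move=> acX i; split.
  move=> y _ [[x y']]; rewrite [LHS]cone_in_funE [RHS]cone_diffE /= => -[] /eqP.
  rewrite eq_sym oppr_eq0 => /eqP /acX[x' ->] ->.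
  by exists (f i x' + y'); rewrite homfD cfunD.
move=> [x y]; rewrite [LHS]cone_diffE => -[] /= /eqP; rewrite oppr_eq0.
move=> /eqP /acX[x' ->] dy; exists (y + f (i + 1) x').
  by rewrite homfD -cfunD [LHS]addrC.
exists (- x', 0); rewrite [X in _ - X]cone_in_funE [RHS]cone_diffE.
by congr pair => /=; rewrite !homfN ?opprK ?subr0 // homf0 addr0 opprD addNKr.
Qed.

(** Since f - g becomes null-homotopic on Q, it factors up to homotopy through
    the cone of s by a map e. The cone of s is acyclic, so the inclusion of Z into
    the cone of e is a quasi-isomorphism, and it kills f - g. *)
Lemma homotopic_precomp_qis Q X Z (s : cmap Q X) (f g : cmap X Z) :
    qis s -> homotopic (cmap_comp f s) (cmap_comp g s) ->
  exists W (t : cmap Z W), qis t /\ homotopic (cmap_comp t f) (cmap_comp t g).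
Proof.
move=> qs [h hh hE].
pose e i : 'Hom(cone s i, Z i) :=
  linfun (fun p : (Q (i + 1)%R * X i)%type => h i p.1 + (f i - g i) p.2).
have eE i p : e i p = h i p.1 + (f i p.2 - g i p.2).
  rewrite /e linfunK => [|c x y]; first by rewrite add_lfunE opp_lfunE.
  by rewrite !linearP /= scalerDr addrACA.
have e_hom i : modhom (e i).
  move=> a p; rewrite !eE dsum_actE /= !hh (cfun_hom f) (cfun_hom g).
  by rewrite -homfB -homfD.
have eD (i : int) p : e (i + 1) (cdiff (cone s) i p) = cdiff Z i (e i p).
  rewrite !eE [cdiff (cone s) i p]cone_diffE /= homfN !homfD opprD addrACA.
  have := hE i p.1; rewrite !cmap_compE => ->.
  by rewrite [LHS]addrA (addrC (- _)) addrK homfN !cfunD.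
pose t := cone_in (CMap e_hom eD).
exists (cone (CMap e_hom eD)), t; split.
  by apply: qis_cone_in => i c; apply: cone_acyclic.
pose H i : 'Hom(X (i + 1), cone (CMap e_hom eD) i) :=
  linfun (fun x => ((0, x), 0) : ((Q (i + 1 + 1)%R * X (i + 1)%R) * Z i)%type).
have HE i x : H i x = ((0, x), 0).
  apply: linfunK => c y z; congr (_, _); last by rewrite /= scaler0 addr0.
  by congr (_, _); rewrite /= scaler0 addr0.
exists H => [i a x|i x].
  by rewrite !HE [RHS]dsum_actE; congr pair; rewrite ?[RHS]dsum_actE /= homf0.
rewrite !HE !cmap_compE ![t _ _]cone_in_funE.
have c : cdiff (cone (CMap e_hom eD)) i ((0, x), 0)
         = ((0, - cdiff X (i + 1) x), f (i + 1) x - g (i + 1) x).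
  rewrite [LHS]cone_diffE; congr pair; rewrite /= ?eE ?cone_diffE /=.
    by rewrite [s _ _]homf0 add0r [cdiff Q _ _]homf0 oppr0; congr pair; rewrite /= oppr0.
  by rewrite !homf0 add0r addr0.
rewrite c; congr (_, _); rewrite /= ?addr0 //.
by congr (_, _); rewrite /= ?subrr ?addr0 ?addNr.
Qed.

(** ** Right fractions *)

(** The morphism g s^-1 as a left fraction. *)
Definition rfrac Q X Y (s : cmap Q X) (qs : qis s) (g : cmap Q Y) : Defs.frac X Y :=
  Frac (hopush_inl s g) (qis_hopush_inr g qs).

(** Fractions out of X may be compared after composition with a
    quasi-isomorphism s : Q -> X. *)
Lemma frac_eq_precomp Q X Y (s : cmap Q X) (a b : Defs.frac X Y) :
    qis s ->
    (forall W (u : cmap (fmid a) W) (v : cmap (fmid b) W),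
       qis (cmap_comp u (fden a)) ->
       homotopic (cmap_comp u (fden a)) (cmap_comp v (fden b)) ->
       homotopic (cmap_comp (cmap_comp u (fnum a)) s)
                 (cmap_comp (cmap_comp v (fnum b)) s)) ->
  frac_eq a b.
Proof.
move=> qs nums; pose u := hopush_inl (fden a) (fden b).
pose v := hopush_inr (fden a) (fden b).
have uv : homotopic (cmap_comp u (fden a)) (cmap_comp v (fden b)).
  exact: hopush_comm.
have qv : qis (cmap_comp v (fden b)).
  exact: qis_comp (qis_hopush_inr _ (fden_qis a)) (fden_qis b).
have qu : qis (cmap_comp u (fden a)) := qis_homotopic (homotopic_sym uv) qv.
have [W [t [qt tE]]] := homotopic_precomp_qis qs (nums _ u v qu uv).
have assoc X' (f : cmap X' (fmid a)) (g : cmap X' (fmid b)) :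
    homotopic (cmap_comp t (cmap_comp u f)) (cmap_comp t (cmap_comp v g)) ->
  homotopic (cmap_comp (cmap_comp t u) f) (cmap_comp (cmap_comp t v) g).
  move=> c; apply: homotopic_trans (homotopicA _ _ _) (homotopic_trans c _).
  exact/homotopic_sym/homotopicA.
exists W, (cmap_comp t u), (cmap_comp t v); split; last exact: assoc.
  exact: qis_homotopic (homotopic_sym (homotopicA _ _ _)) (qis_comp qt qu).
exact/assoc/homotopic_compl.
Qed.

(** If all morphisms X -> Y vanish and Y is isomorphic to X', then e^-1 f s^-1
    vanishes, which means that some quasi-isomorphism t out of X' makes t f
    null-homotopic. *)
Lemma frac_zero_null Q X X' Y (s : cmap Q X) (e : Defs.frac Y X') (f : cmap Q X') :
    qis s -> qis (fnum e) ->
    (forall a : Defs.frac X Y, exists b, frac_eq a (frac_scale 0 b)) ->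
  exists W (t : cmap X' W), qis t /\
    exists2 h : forall i : int, 'Hom(Q (i + 1), W i), (forall i : int, modhom (h i)) &
      forall (i : int) x,
        t (i + 1) (f (i + 1) x) = cdiff W i (h i x) + h (i + 1) (cdiff Q (i + 1) x).
Proof.
move=> qs qe XY0.
have [b [W [u [v [qu _ num]]]]] :=
  XY0 (Frac (hopush_inl s (cmap_comp (fden e) f)) (qis_comp (qis_hopush_inr _ qs) qe)).
move: (hopush_comm s (cmap_comp (fden e) f)) u qu num => /=.
move: (hopush_inl s _) (hopush_inr s _) => inl inr c u qu num.
have qui : qis (cmap_comp u inr).
  exact: qis_cancel qe (qis_homotopic (homotopic_sym (homotopicA _ _ _)) qu).
exists W, (cmap_comp (cmap_comp u inr) (fden e)).
split; first exact: qis_comp qui (fden_qis e).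
have [h hh hE] : homotopic (cmap_comp (cmap_comp (cmap_comp u inr) (fden e)) f)
                           (cmap_comp (cmap_comp v (cmap_scale 0 (fnum b))) s).
  apply: homotopic_trans (homotopicA _ _ _) _.
  apply: homotopic_trans (homotopicA _ _ _) _.
  apply: homotopic_trans (homotopic_compl u (homotopic_sym c)) _.
  apply: homotopic_trans (homotopic_sym (homotopicA _ _ _)) _.
  exact: (homotopic_compr s num).
exists h => // i x; rewrite -hE -(cmap_compE _ f).
rewrite (cmap_compE _ s) (cmap_compE v (cmap_scale 0 _)) scale_lfunE scale0r.
by rewrite homf0 subr0.
Qed.

End Localization.

(** * Resolving a complex over a hereditary algebra *)

Lemma dim0P (k : fieldType) (V : vectType k) :
  \dim (fullv : {vspace V}) = 0%N <-> forall x : V, x = 0.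
Proof.
split=> [/eqP|V0].
  by rewrite dimv_eq0 => /eqP V0 x; apply/eqP; rewrite -memv0 -V0 memvf.
by apply/eqP; rewrite dimv_eq0 -subv0; apply/subvP => x _; rewrite (V0 x) mem0v.
Qed.

Lemma vsval0 (k : fieldType) (V : vectType k) (U : {vspace V}) :
  vsval (0 : subvs_of U) = 0.
Proof. exact: linear0. Qed.

Section Resolution.
Variables (k : fieldType) (A : falgType k) (X : cplx A).

(** Free on a basis of the cocycles, so that it vanishes wherever X does and the
    resolution stays bounded. *)
Definition cocycle_cover (i : int) : fdmod A :=
  free_mod A (\dim (lker (cdiff X i))).
Notation P := cocycle_cover.

Definition cover_map (i : int) : 'Hom(P i, X i) :=
  free_hom (fun l => (vbasis (lker (cdiff X i)))`_l).
Notation pi := cover_map.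

Lemma cover_map_hom (i : int) : modhom (pi i).
Proof. exact: free_hom_hom. Qed.

Lemma cover_map_cycle (i : int) p : cdiff X i (pi i p) = 0.
Proof.
rewrite free_homE linear_sum big1 // => l _ /=; rewrite cdiff_hom.
have : (vbasis (lker (cdiff X i)))`_l \in lker (cdiff X i).
  by apply: vbasis_mem; rewrite mem_nth ?size_tuple.
by rewrite memv_ker => /eqP ->; rewrite homf0.
Qed.

Lemma cover_map_onto (i : int) x : cdiff X i x = 0 -> exists p, x = pi i p.
Proof.
move=> dx; have : x \in lker (cdiff X i) by rewrite memv_ker dx.
move=> /coord_vbasis ->.
exists (\sum_l coord (vbasis (lker (cdiff X i))) l x *: free_gen A l).
rewrite linear_sum; apply: eq_bigr => l _ /=.
by rewrite homfZ free_hom_gen.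
Qed.

Lemma cover_projective (i : int) : projective (P i).
Proof. exact: free_projective. Qed.

(** The preimage of the coboundaries of degree i + 1, so that P (i + 1) / R i is
    the cohomology of X in degree i + 1. *)
Definition cobound_cover (i : int) : {vspace P (i + 1)} :=
  (pi (i + 1) @^-1: limg (cdiff X i))%VS.
Notation R := cobound_cover.

Lemma cobound_coverP (i : int) (p : P (i + 1)) :
  p \in R i <-> exists w, pi (i + 1) p = cdiff X i w.
Proof.
rewrite -memv_preim; split=> [/memv_imgP[w _ e]|[w ->]]; first by exists w.
by rewrite memv_img ?memvf.
Qed.

Lemma cobound_cover_coh (i : int) (p q : P (i + 1)) :
  p - q \in R i <-> cohomologous (pi (i + 1) p) (pi (i + 1) q).
Proof. by rewrite cobound_coverP homfB. Qed.

Lemma cobound_cover_stable (i : int) a p : p \in R i -> mact (P (i + 1)) a p \in R i.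
Proof.
move=> /cobound_coverP[w e]; apply/cobound_coverP; exists (mact _ a w).
by rewrite cover_map_hom e cdiff_hom.
Qed.

Definition cobound_mod (i : int) : fdmod A := submod (@cobound_cover_stable i).
Notation Rm := cobound_mod.

Hypothesis her : hereditary A.

Lemma cobound_projective (i : int) : projective (Rm i).
Proof. exact: proj_submod her (@cover_projective _). Qed.

(** By heredity the submodule R i of a free module is projective, so its map to
    the coboundaries lifts to X i. *)
Lemma cobound_lift (i : int) :
  exists lam : 'Hom(Rm i, X i),
    modhom lam /\ forall r, cdiff X i (lam r) = pi (i + 1) (vsval r).
Proof.
have hf := modhom_comp (@cover_map_hom (i + 1))
                       (@submod_incl_hom _ _ _ _ (@cobound_cover_stable i)).
have [|lam hlam lamE] := proj_lift (@cobound_projective i) (@cdiff_hom _ _ X i) hf.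
  by move=> r; rewrite comp_lfunE submod_inclE; apply/cobound_coverP/subvsP.
by exists lam; split=> // r; rewrite lamE comp_lfunE submod_inclE.
Qed.

Definition reso_lift (i : int) : 'Hom(Rm i, X i) :=
  sval (ClassicalEpsilon.constructive_indefinite_description _ (cobound_lift i)).
Notation lam := reso_lift.

Lemma reso_lift_hom (i : int) : modhom (lam i).
Proof.
by rewrite /lam; case: ClassicalEpsilon.constructive_indefinite_description => l [].
Qed.

Lemma reso_liftD (i : int) r : cdiff X i (lam i r) = pi (i + 1) (vsval r).
Proof.
by rewrite /lam; case: ClassicalEpsilon.constructive_indefinite_description => l [_ ->].
Qed.

Definition reso_diff (i : int) :
    'Hom(dsum (Rm i) (P i), dsum (Rm (i + 1)) (P (i + 1))) :=
  linfun (fun u : (Rm i * P i)%type => (0, vsval u.1) : dsum (Rm (i + 1)) (P (i + 1))).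

Lemma reso_diffE i u : reso_diff i u = (0, vsval u.1).
Proof. by apply: linfunK => c x y; congr pair; rewrite /= ?linearP ?scaler0 ?addr0. Qed.

Fact reso_diff_hom i : modhom (reso_diff i).
Proof.
move=> a u; rewrite !reso_diffE !dsum_actE; congr pair; first by rewrite /= homf0.
exact: submod_actE (@cobound_cover_stable i) a u.1.
Qed.

Fact reso_diffK (i : int) u : reso_diff (i + 1) (reso_diff i u) = 0.
Proof. by rewrite !reso_diffE vsval0. Qed.

Fact reso_bounded : exists n : nat, forall i : int,
  (n < `|i|)%N -> \dim (fullv : {vspace dsum (Rm i) (P i)}) = 0%N.
Proof.
have [n bX] := cbounded X; exists n.+1 => i ni.
have P0 (j : int) : (n < `|j|)%N -> forall p : P j, p = 0.
  move=> /bX X0 p; apply/ffunP => l; exfalso.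
  by case: l => l /leq_trans/(_ (dimvS (subvf _))); rewrite X0.
apply: dim_pair0; apply/dim0P; last by apply: P0; lia.
by move=> r; apply: val_inj; rewrite [LHS]P0 ?vsval0 //; lia.
Qed.

(** The sum over i of the two-term complexes R i -> P (i + 1) in degrees i and
    i + 1; the component of degree i is R i (+) P i. *)
Definition reso : cplx A := Cplx reso_diff_hom reso_diffK reso_bounded.

(** The resolution is a sum of inclusions R i -> P (i + 1), so a map out of it is
    the choice of a map on each P i with values in cocycles and of a primitive of
    its restriction to each R i. *)
Lemma reso_map (Z : cplx A) (f : forall i : int, 'Hom(Rm i, Z i))
    (g : forall i : int, 'Hom(P i, Z i)) :
    (forall i : int, modhom (f i)) -> (forall i : int, modhom (g i)) ->
    (forall (i : int) p, cdiff Z i (g i p) = 0) ->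
    (forall (i : int) r, cdiff Z i (f i r) = g (i + 1) (vsval r)) ->
  exists h : cmap reso Z, forall (i : int) r p, h i (r, p) = f i r + g i p.
Proof.
move=> hf hg dg df.
pose h i : 'Hom(reso i, Z i) :=
  linfun (fun u : (Rm i * P i)%type => f i u.1 + g i u.2).
have hE i u : h i u = f i u.1 + g i u.2.
  by apply: linfunK => c x y; rewrite !linearP /= scalerDr addrACA.
have hh i : modhom (h i) by move=> a u; rewrite !hE dsum_actE /= hf hg homfD.
have hD (i : int) u : h (i + 1) (cdiff reso i u) = cdiff Z i (h i u).
  by rewrite !hE [cdiff reso i u]reso_diffE homfD dg df addr0 homf0 add0r.
by exists (CMap hh hD) => i r p; rewrite /= hE.
Qed.

(** The lifts of cobound_lift make the covers of the cocycles into a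
    quasi-isomorphism from the resolution. *)
Lemma reso_qis : exists2 s : cmap reso X, qis s &
  forall (i : int) r p, s i (r, p) = lam i r + pi i p.
Proof.
have [s sE] := reso_map reso_lift_hom cover_map_hom cover_map_cycle reso_liftD.
exists s => // i; split.
  move=> [r p]; rewrite [LHS]reso_diffE => -[r0] [w].
  have -> : r = 0 by apply: val_inj; rewrite [LHS]r0 [RHS]vsval0.
  rewrite sE homf0 add0r => e.
  have /cobound_coverP pR : exists w, pi (i + 1) p = cdiff X i w by exists w.
  by exists (vsproj (R i) p, 0); rewrite [RHS]reso_diffE /= vsprojK.
move=> x /cover_map_onto[p ->]; exists (0, p); first by rewrite [LHS]reso_diffE vsval0.
by exists 0; rewrite sE !homf0 add0r subrr.
Qed.

End Resolution.

Lemma cshift_cycle (k : fieldType) (A : falgType k) (X : cplx A) (i : int)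
    (x : cshift X i) :
  cdiff (cshift X) i x = 0 <-> cdiff X (i + 1) x = 0.
Proof.
rewrite /= opp_lfunE; split=> [/eqP|->]; last by rewrite oppr0.
by rewrite oppr_eq0 => /eqP.
Qed.

(** * Endomorphisms of a complex through its resolution *)

Section Endomorphisms.
Variables (k : fieldType) (A : falgType k) (her : hereditary A) (X : cplx A).
Notation P := (cocycle_cover X).
Notation pi := (@cover_map _ _ X).
Notation R := (@cobound_cover _ _ X).
Notation Rm := (@cobound_mod _ _ X).

Definition reso_inP (i : int) : 'Hom(P i, reso X i) :=
  linfun (fun p => (0, p) : dsum (Rm i) (P i)).
Definition reso_inR (i : int) : 'Hom(Rm i, reso X i) :=
  linfun (fun r => (r, 0) : dsum (Rm i) (P i)).

Lemma reso_inPE (i : int) p : reso_inP i p = (0, p).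
Proof. by apply: linfunK => c x y; congr pair; rewrite /= scaler0 addr0. Qed.

Lemma reso_inRE (i : int) r : reso_inR i r = (r, 0).
Proof. by apply: linfunK => c x y; congr pair; rewrite /= scaler0 addr0. Qed.

Lemma reso_inP_hom (i : int) : modhom (reso_inP i).
Proof. by move=> a p; rewrite !reso_inPE [RHS]dsum_actE /= homf0. Qed.

Lemma reso_inR_hom (i : int) : modhom (reso_inR i).
Proof. by move=> a p; rewrite !reso_inRE [RHS]dsum_actE /= homf0. Qed.

Lemma reso_diff_inP (i : int) p : cdiff (reso X) i (reso_inP i p) = 0.
Proof. by rewrite reso_inPE [LHS]reso_diffE vsval0. Qed.

Lemma reso_diff_inR (i : int) r :
  cdiff (reso X) i (reso_inR i r) = reso_inP (i + 1) (vsval r).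
Proof. by rewrite reso_inRE reso_inPE [LHS]reso_diffE. Qed.

Lemma reso_decomp (i : int) (u : reso X i) : u = reso_inR i u.1 + reso_inP i u.2.
Proof.
by case: u => r p; rewrite reso_inRE reso_inPE; congr pair; rewrite /= ?addr0 ?add0r.
Qed.

(** Let u = f - g. In degrees other than n + 1 the cohomology of X vanishes, so
    that R i is all of P (i + 1) and u on R i serves as a homotopy on P (i + 1). On
    P (n + 1) the values of u are coboundaries, and projectivity gives the
    homotopy h; the defect of h on R n is a cocycle of degree n in Z, hence a
    coboundary, which gives the remaining component e. *)
Lemma reso_homotopic (Z : cplx A) (n : int) (f g : cmap (reso X) Z) :
    (forall i : int, i != n -> forall p, p \in R i) ->
    (forall i : int, i != n -> forall z : Z (i + 1), cdiff Z (i + 1) z = 0 ->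
       cohomologous z 0) ->
    (forall p, cohomologous (f (n + 1) (reso_inP (n + 1) p))
                            (g (n + 1) (reso_inP (n + 1) p))) ->
  homotopic f g.
Proof.
move=> fullR acZ fg.
have [u uE] : exists u : cmap (reso X) Z, forall i x, u i x = f i x - g i x.
  exists (cmap_add f (cmap_scale (-1) g)) => i x.
  by rewrite add_lfunE scale_lfunE scaleN1r.
have hP (i : int) : exists h : 'Hom(P (i + 1), Z i), [/\ modhom h,
    forall p, cdiff Z i (h p) = u (i + 1) (reso_inP (i + 1) p) &
    i != n -> forall r, h (vsval r) = u i (reso_inR i r)].
  have [->|ne] := eqVneq i n.
    have hu := modhom_comp (@cfun_hom _ _ _ _ u (n + 1)) (@reso_inP_hom (n + 1)).
    have [|h hh hE] := proj_lift (@cover_projective _ _ _ _) (@cdiff_hom _ _ Z n) hu.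
      by move=> p; have [w e] := fg p; exists w; rewrite comp_lfunE uE.
    by exists h; split=> // p; rewrite hE comp_lfunE.
  have [v hv vE] := submod_corestr (@cobound_cover_stable _ _ X i)
                       (@modhom1 _ _ _) (fun p => fullR i ne _).
  exists (u i \o (reso_inR i \o v))%VF; split.
  - apply: modhom_comp; first exact: cfun_hom.
    by apply: modhom_comp => //; apply: reso_inR_hom.
  - by move=> p; rewrite !comp_lfunE -cfunD reso_diff_inR vE id_lfunE.
  move=> _ r; rewrite !comp_lfunE; congr (u i (reso_inR i _)).
  by apply: val_inj; rewrite [LHS]vE id_lfunE.
have {}hP (i : int) := ClassicalEpsilon.constructive_indefinite_description _ (hP i).
pose h (i : int) := sval (hP i).
have hh (i : int) : modhom (h i) by case: (svalP (hP i)).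
have hE (i : int) p : cdiff Z i (h i p) = u (i + 1) (reso_inP (i + 1) p).
  by case: (svalP (hP i)).
have hE' (i : int) r : i != n -> h i (vsval r) = u i (reso_inR i r).
  by case: (svalP (hP i)) => _ _ e ne; apply: e.
have gP (i : int) : exists e : 'Hom(Rm (i + 1), Z i), modhom e /\
    forall r, cdiff Z i (e r) = u (i + 1) (reso_inR (i + 1) r) - h (i + 1) (vsval r).
  have [ne|en] := eqVneq (i + 1) n; last first.
    exists 0; split=> [|r]; first exact: modhom0.
    by rewrite zero_lfunE homf0 hE' // subrr.
  pose f' : 'Hom(Rm (i + 1), Z (i + 1)) :=
    (u (i + 1) \o reso_inR (i + 1))%VF
    - (h (i + 1) \o submod_incl (@cobound_cover_stable _ _ X (i + 1)))%VF.
  have f'E r : f' r = u (i + 1) (reso_inR (i + 1) r) - h (i + 1) (vsval r).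
    by rewrite add_lfunE opp_lfunE !comp_lfunE submod_inclE.
  have hf' : modhom f'.
    apply: modhomD (modhomN _); apply: modhom_comp; rewrite //.
    - exact: cfun_hom.
    - exact: reso_inR_hom.
    - exact: submod_incl_hom.
  have [|e he eE] := proj_lift (cobound_projective her (i := i + 1))
                         (@cdiff_hom _ _ Z i) hf'.
    move=> r; have [||w e] := acZ i _ (f' r).
    - by rewrite -ne; lia.
    - by rewrite f'E homfB hE -cfunD reso_diff_inR subrr.
    by exists w; rewrite -e subr0.
  by exists e; split=> // r; rewrite eE f'E.
have {}gP (i : int) := ClassicalEpsilon.constructive_indefinite_description _ (gP i).
pose e (i : int) := sval (gP i).
have he (i : int) : modhom (e i) by case: (svalP (gP i)).
have eE (i : int) r :
    cdiff Z i (e i r) = u (i + 1) (reso_inR (i + 1) r) - h (i + 1) (vsval r).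
  by case: (svalP (gP i)).
pose H i : 'Hom(reso X (i + 1), Z i) :=
  linfun (fun x : (Rm (i + 1) * P (i + 1)%R)%type => e i x.1 + h i x.2).
have HE i x : H i x = e i x.1 + h i x.2.
  by apply: linfunK => c y z; rewrite !linearP /= scalerDr addrACA.
exists H => [i a x|i x]; first by rewrite !HE dsum_actE /= he hh homfD.
rewrite -uE !HE [x in u _ x]reso_decomp [cdiff _ _ x]reso_diffE /= homf0 add0r.
by rewrite !homfD eE hE [RHS]addrAC subrK.
Qed.

Lemma frac_coh_cobound (i : int) (a : Defs.frac X X) (F : 'End(P (i + 1))) :
    (forall p, frac_coh a (pi (i + 1) p) (pi (i + 1) (F p))) ->
  forall p, p \in R i -> F p \in R i.
Proof.
move=> aF p; rewrite -[p]subr0 cobound_cover_coh => p0.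
rewrite subr0 -[F p]subr0 cobound_cover_coh homf0.
apply: (qis_inj (fden_qis a)); rewrite ?cover_map_cycle ?homf0 //.
apply: coh_trans (coh_sym (aF p)) _.
by have := coh_map (fnum a) p0; rewrite !homf0.
Qed.

(** The action of a fraction on H^(i+1)(X) lifts to the projective P (i + 1). *)
Lemma frac_coh_lift (i : int) (a : Defs.frac X X) :
  exists2 F : 'End(P (i + 1)), modhom F &
    forall p, frac_coh a (pi (i + 1) p) (pi (i + 1) (F p)).
Proof.
pose g : 'Hom(dsum (P (i + 1)) (fmid a i), fmid a (i + 1)) :=
  linfun (fun u : (P (i + 1)%R * fmid a i)%type =>
            fden a (i + 1) (pi (i + 1) u.1) + cdiff (fmid a) i u.2).
have gE u : g u = fden a (i + 1) (pi (i + 1) u.1) + cdiff (fmid a) i u.2.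
  by apply: linfunK => c x y; rewrite !linearP /= scalerDr addrACA.
have hg : modhom g.
  by move=> b u; rewrite !gE dsum_actE /= cover_map_hom cfun_hom cdiff_hom homfD.
have hf := modhom_comp (@cfun_hom _ _ _ _ (fnum a) (i + 1))
                       (@cover_map_hom _ _ X (i + 1)).
have [|h hh hE] := proj_lift (@cover_projective _ _ _ _) hg hf.
  move=> p; have [y dy [w e]] := frac_coh_total a (cover_map_cycle p).
  have [q eq] := cover_map_onto dy.
  by exists (q, w); rewrite gE /= -e -eq comp_lfunE [RHS]addrC subrK.
have FE : linfun (fun p => (h p).1) =1 (fun p => (h p).1).
  by apply: linfunK => c x y; rewrite linearP.
exists (linfun (fun p => (h p).1)) => [b p|p]; first by rewrite !FE hh dsum_actE.
exists (h p).2; rewrite FE; have := hE p; rewrite gE comp_lfunE => <-.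
by rewrite [LHS]addrC addKr.
Qed.

Variables (s : cmap (reso X) X) (qs : qis s).
Hypothesis sE : forall (i : int) r p, s i (r, p) = reso_lift X her i r + pi i p.

Lemma reso_inP_coh (i : int) p : s i (reso_inP i p) = pi i p.
Proof. by rewrite reso_inPE sE homf0 add0r. Qed.

(** Every family of endomorphisms of the modules P (i + 1) / R i comes from an
    endomorphism of X in the derived category, since the resolution splits as a
    sum over i. *)
Lemma frac_coh_realize (G : forall i : int, 'End(P i)) :
    (forall i : int, modhom (G i)) ->
    (forall (i : int) p, p \in R i -> G (i + 1) p \in R i) ->
  exists a : Defs.frac X X, forall (i : int) p,
    frac_coh a (pi (i + 1) p) (pi (i + 1) (G (i + 1) p)).
Proof.
move=> hG GR; have restr (i : int) : exists g : 'Hom(Rm i, Rm i),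
    modhom g /\ forall r, vsval (g r) = G (i + 1) (vsval r).
  have hi := modhom_comp (hG (i + 1))
                         (@submod_incl_hom _ _ _ _ (@cobound_cover_stable _ _ X i)).
  have [|g hg gE] := submod_corestr (@cobound_cover_stable _ _ X i) hi.
    by move=> r; rewrite comp_lfunE submod_inclE GR ?subvsP.
  by exists g; split=> // r; rewrite gE comp_lfunE submod_inclE.
have {}restr (i : int) := ClassicalEpsilon.constructive_indefinite_description _ (restr i).
pose g (i : int) := sval (restr i).
have [||||h hE] := @reso_map _ _ X X (fun i => reso_lift X her i \o g i)%VF
                                    (fun i => pi i \o G i)%VF.
- move=> i; apply: modhom_comp; first exact: reso_lift_hom.
  by case: (svalP (restr i)).
- by move=> i; apply: modhom_comp; first exact: cover_map_hom.
- by move=> i p; rewrite comp_lfunE cover_map_cycle.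
- move=> i r; rewrite !comp_lfunE reso_liftD.
  by case: (svalP (restr i)) => _ ->.
exists (rfrac qs h) => i p; have := hopush_coh s h (reso_diff_inP p).
by rewrite reso_inP_coh reso_inPE hE homf0 add0r comp_lfunE.
Qed.

Lemma frac_coh_realize1 (i : int) (G : 'End(P (i + 1))) :
    modhom G -> (forall p, p \in R i -> G p \in R i) ->
  exists a : Defs.frac X X, forall p,
    frac_coh a (pi (i + 1) p) (pi (i + 1) (G p)).
Proof.
move=> hG GR.
pose Gs := @dfwith _ (fun j : int => 'End(P j)) (fun=> 0) _ G.
have [||a aE] := frac_coh_realize (G := Gs).
- move=> j; have [<-|ne] := eqVneq (i + 1) j; first by rewrite /Gs dfwith_in.
  by rewrite /Gs dfwith_out //; apply: modhom0.
- move=> j; have [<-|ne] := eqVneq i j; first by rewrite /Gs dfwith_in; apply: GR.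
  move=> p; rewrite /Gs dfwith_out ?zero_lfunE ?mem0v //.
  by apply: contraNneq ne => /addIr ->.
by exists a => p; have := aE i p; rewrite /Gs dfwith_in.
Qed.

(** With cohomology in a single degree there is no Ext^1 between different
    cohomology modules, so endomorphisms of X are determined by their action on
    cohomology. *)
Lemma frac_coh_faithful (n : int) (a b : Defs.frac X X) :
    (forall i : int, i != n -> forall p, p \in R i) ->
    (forall p, exists q, frac_coh a (pi (n + 1) p) (pi (n + 1) q) /\
                         frac_coh b (pi (n + 1) p) (pi (n + 1) q)) ->
  frac_eq a b.
Proof.
move=> fullR ab; apply: (frac_eq_precomp qs) => W u v qu uv.
apply: (reso_homotopic fullR).
  move=> i ne z dz; have [x dx zx] := qis_surj qu dz.
  apply: (coh_trans zx); rewrite -(homf0 (cmap_comp u (fden a) (i + 1))).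
  apply: coh_map; have [p ->] := cover_map_onto dx.
  by have := fullR i ne p; rewrite -{1}[p]subr0 cobound_cover_coh homf0.
move=> p; have [q [ap bp]] := ab p.
rewrite (cmap_compE _ s) (cmap_compE (cmap_comp v _)) reso_inP_coh.
rewrite !(cmap_compE u) !(cmap_compE v).
have dq := @cover_map_cycle _ _ X _ q.
have := coh_homotopic uv dq; rewrite !cmap_compE => den.
exact: coh_trans (coh_trans (coh_map _ ap) den) (coh_sym (coh_map _ bp)).
Qed.

(** The composite of phi with the cover of the cocycles is a map psi from the
    resolution to the shift of X. Once it is null-homotopic after a
    quasi-isomorphism t, the homotopy on P (j + 2) has values in cocycles; lifting
    these through t and through the cover gives mu. Thus the vanishing of
    Hom(X, X[1]) forces Ext^1 of a cohomology module with itself to vanish. *)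
Lemma frac_ext1 (Y : cplx A) (e : Defs.frac Y (cshift X)) (j : int) :
    qis (fnum e) -> (forall a : Defs.frac X Y, exists b, frac_eq a (frac_scale 0 b)) ->
  forall phi : 'Hom(Rm (j + 1), P (j + 1 + 1)), modhom phi ->
  exists2 mu : 'End(P (j + 1 + 1)), modhom mu &
    forall r, phi r - mu (vsval r) \in R (j + 1).
Proof.
move=> qe XY0 phi hphi.
pose f := @dfwith _ (fun i : int => 'Hom(Rm i, cshift X i)) (fun=> 0) (j + 1)
           (pi (j + 1 + 1) \o phi)%VF.
have [||||psi psiE] := @reso_map _ _ X (cshift X) f (fun=> 0).
- move=> i; have [<-|ne] := eqVneq (j + 1) i; last first.
    by rewrite /f dfwith_out //; apply: modhom0.
  by rewrite /f dfwith_in; apply: modhom_comp (@cover_map_hom _ _ X _) hphi.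
- by move=> i; apply: modhom0.
- by move=> i p; rewrite zero_lfunE homf0.
- move=> i; have [<-|ne] := eqVneq (j + 1) i => r; rewrite zero_lfunE; last first.
    by rewrite /f dfwith_out // zero_lfunE homf0.
  rewrite /f dfwith_in comp_lfunE; apply/cshift_cycle.
  exact: (cover_map_cycle (phi r)).
have [W [t [qt [h hh hE]]]] := frac_zero_null psi qs qe XY0.
pose hP : 'Hom(P (j + 1 + 1), W (j + 1)) := (h (j + 1) \o reso_inP (j + 1 + 1))%VF.
have hhP : modhom hP by apply: modhom_comp (hh _) (@reso_inP_hom _).
have dhP p : cdiff W (j + 1) (hP p) = 0.
  have := hE (j + 1) (reso_inP _ p).
  rewrite reso_diff_inP homf0 addr0 reso_inPE psiE homf0 zero_lfunE addr0 homf0.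
  by rewrite comp_lfunE reso_inPE.
pose q : 'Hom(dsum (P (j + 1 + 1)) (W j), W (j + 1)) :=
  linfun (fun x : (P (j + 1 + 1)%R * W j)%type =>
            t (j + 1) (pi (j + 1 + 1) x.1 : cshift X (j + 1)) + cdiff W j x.2).
have qE x : q x = t (j + 1) (pi (j + 1 + 1) x.1) + cdiff W j x.2.
  by apply: linfunK => c y z; rewrite !linearP /= scalerDr addrACA.
have hq : modhom q.
  move=> a x; rewrite !qE dsum_actE /= cover_map_hom.
  by rewrite (@cfun_hom _ _ _ _ t (j + 1) a) cdiff_hom homfD.
have [|l hl lE] := proj_lift (@cover_projective _ _ _ _) hq hhP.
  move=> p; have [x dx [w ew]] := qis_surj qt (dhP p).
  have dx' : cdiff X (j + 1 + 1) x = 0.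
    exact/cshift_cycle.
  have [p' ep'] := cover_map_onto dx'.
  by exists (p', w); rewrite qE /= -ew -ep' [RHS]addrC subrK.
have muE : linfun (fun p => (l p).1) =1 (fun p => (l p).1).
  by apply: linfunK => c x y; rewrite linearP.
exists (linfun (fun p => (l p).1)) => [a p|r]; first by rewrite !muE hl dsum_actE.
have : @cohomologous _ _ (cshift X) j (pi _ (phi r)) (pi _ (l (vsval r)).1).
  apply: (qis_inj qt); rewrite ?cshift_cycle ?(cover_map_cycle (i := j + 1 + 1)) //.
  have := hE j (reso_inR _ r); rewrite reso_diff_inR reso_inRE psiE zero_lfunE addr0.
  rewrite {1}/f dfwith_in comp_lfunE => ->; have := lE (vsval r).
  rewrite qE comp_lfunE => <-; exists (h j (r, 0) + (l (vsval r)).2).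
  by rewrite homfD [X in X - _]addrA [LHS]addrAC addrK.
move=> [w]; rewrite -homfB opp_lfunE -homfN => ew.
by rewrite muE; apply/cobound_coverP; exists (- w).
Qed.

End Endomorphisms.

(** * Corner algebras of primitive idempotents *)

Lemma cornerP (k : fieldType) (A : falgType k) (e a : A) :
  e * e = e -> a \in corner e -> e * a = a /\ a * e = a.
Proof.
move=> ee /memv_cosetP[u uC ->]; rewrite -mulrA ee mulrA; split=> //.
have sub : (<[e]> * fullv <= lker (amull e - \1%VF))%VS.
  apply/prodvP => _ x /vlineP[c ->] _; rewrite memv_ker add_lfunE opp_lfunE.
  by rewrite id_lfunE lfunE /= -scalerAl -scalerAr mulrA ee subrr.
have := subvP sub u uC; rewrite memv_ker add_lfunE opp_lfunE id_lfunE lfunE /=.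
by rewrite subr_eq0 => /eqP ->.
Qed.

(** The powers of x up to the dimension of A are linearly dependent. *)
Lemma annihilating_poly (k : fieldType) (A : falgType k) (x : A) :
  exists2 p : {poly k}, p != 0 & horner_alg x p = 0.
Proof.
pose n := (\dim {:A}).+1.
pose f : 'Hom('rV[k]_n, A) := linfun (fun v : 'rV[k]_n => horner_alg x (rVpoly v)).
have fE v : f v = horner_alg x (rVpoly v).
  by rewrite /f linfunK // => c u w; rewrite !linearP /= mulr_algl.
have : lker f != 0%VS.
  rewrite -dimv_eq0 -lt0n -(ltn_add2r (\dim (limg f))) add0n -[lker f]capfv limg_ker_dim.
  have -> : \dim {: 'rV[k]_n} = n by rewrite dimvf /dim /= mul1n.
  by rewrite ltnS dimvS ?subvf.
rewrite -vpick0; set v := vpick _ => v0; exists (rVpoly v).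
  by apply: contraNneq v0 => e; rewrite -[v]rVpolyK e linear0.
by rewrite -fE; apply/eqP; rewrite -memv_ker memv_pick.
Qed.

(** Let c be a root of a polynomial p that kills x, and write p = q r with
    r = (X - c)^m coprime to q. A Bezout relation u q + v r = 1, evaluated at x in
    e A e, splits e into orthogonal idempotents, one of which vanishes: either already q
    kills x, and q is smaller than p, or r does. *)
Lemma corner_eigenvalue (k : closedFieldType) (A : falgType k) (e x : A) :
    primitive_idempotent e -> e * x = x -> x * e = x ->
  exists c m, (x - c *: e) ^+ m.+1 = 0.
Proof.
move=> [e0 ee prim] ex xe.
have comm p : horner_alg x p * e = e * horner_alg x p.
  elim/poly_ind: p => [|p c IHp]; first by rewrite rmorph0 mul0r mulr0.
  rewrite rmorphD rmorphM /= horner_algX horner_algC mulrDl mulrDr -mulrA xe.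
  rewrite [e * (_ * x)]mulrA -IHp -[_ * e * x]mulrA ex.
  by rewrite -scalerAl -scalerAr mul1r mulr1.
pose ev p := horner_alg x p * e.
have evM p q : ev (p * q) = ev p * ev q.
  by rewrite /ev rmorphM /= -[RHS]mulrA [e * (_ * e)]mulrA -comm -[_ * e * e]mulrA ee mulrA.
have evD p q : ev (p + q) = ev p + ev q by rewrite /ev rmorphD mulrDl.
have ev1 : ev 1 = e by rewrite /ev rmorph1 mul1r.
have [p p0 xp] := annihilating_poly x.
have {xp}: ev p = 0 by rewrite /ev xp mul0r.
have [n] := ubnP (size p); elim: n => // n IHn in p p0 *; rewrite ltnS => pn evp.
have [c pc] : exists c, root p c.
  apply/closed_rootP; apply: contraNneq e0 => /eqP/size_poly1P[c c0 ep].
  move: evp; rewrite ep /ev horner_algC -scalerAl mul1r => /eqP.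
  by rewrite scaler_eq0 (negPf c0).
have [m [q qc ep]] := multiplicity_XsubC p c.
have {}qc : ~~ root q c by move: qc; rewrite p0.
case: m ep => [|m] ep; first by case/negP: qc; move: pc; rewrite ep expr0 mulr1.
pose r := ('X - c%:P) ^+ m.+1.
have /Bezout_eq1_coprimepP[[u v] /= uv] : coprimep q r.
  by rewrite coprimep_expr // coprimep_XsubC.
have evqr : ev q * ev r = 0 by rewrite -evM -ep.
have evrq : ev r * ev q = 0 by rewrite -evM mulrC evM.
have fg : ev (u * q) * ev (v * r) = 0.
  by rewrite -evM mulrACA evM [ev (q * r)]evM evqr mulr0.
have gf : ev (v * r) * ev (u * q) = 0.
  by rewrite -evM mulrACA evM [ev (r * q)]evM evrq mulr0.
have efg : e = ev (u * q) + ev (v * r) by rewrite -evD uv ev1.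
have eve y : ev y * e = ev y by rewrite /ev -mulrA ee.
have ff : ev (u * q) * ev (u * q) = ev (u * q).
  by rewrite -[RHS]eve efg mulrDr fg addr0.
have gg : ev (v * r) * ev (v * r) = ev (v * r).
  by rewrite -[RHS]eve [in RHS]efg mulrDr gf add0r.
have [f0|g0] := prim _ _ ff gg fg gf efg.
  apply: (IHn q); last by rewrite -eve efg f0 add0r -evM mulrCA evM -ep evp mulr0.
    by apply: contraNneq p0 => q0; rewrite ep q0 mul0r.
  apply: leq_trans pn; rewrite ep size_Mmonic ?monicXn ?monic_exp ?monicXsubC //.
    by rewrite size_exp_XsubC addnS /= -[X in (X < _)%N]addn0 ltn_add2l.
  by apply: contraNneq p0 => q0; rewrite ep q0 mul0r.
exists c, m; have evr : ev r = 0.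
  by rewrite -eve efg g0 addr0 -evM mulrCA evM [ev (r * q)]evM evrq mulr0.
have ce : GRing.comm (x - c%:A) e.
  by rewrite /GRing.comm mulrBl mulrBr xe ex -scalerAl -scalerAr mul1r mulr1.
have -> : x - c *: e = (x - c%:A) * e by rewrite mulrBl xe -scalerAl mul1r.
rewrite exprMn_comm //; have -> : e ^+ m.+1 = e.
  by elim: m {r evr ep uv evqr evrq fg gf efg ff gg g0} => // m IHm; rewrite exprS IHm ee.
by move: evr; rewrite /ev /r rmorphXn rmorphB /= horner_algX horner_algC.
Qed.

(** * The projective module A e as a complex *)

Lemma lidealP (k : fieldType) (A : falgType k) (f x : A) :
  f * f = f -> (x \in lideal f) = (x * f == x).
Proof.
move=> ff; apply/memv_cosetP/eqP => [[u _ ->]|<-]; first by rewrite -mulrA ff.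
by exists x; rewrite ?memvf.
Qed.

Section Stalk.
Variables (k : fieldType) (A : falgType k) (e : A) (n : int).
Hypothesis ee : e * e = e.

(** The stalk complex has A e in degree n + 1 and the zero module A 0 in the other
    degrees, so that its elements are elements of A in every degree. *)
Definition stalk_idem (i : int) : A := if i == n + 1 then e else 0.

Lemma stalk_idem_idem i : stalk_idem i * stalk_idem i = stalk_idem i.
Proof. by rewrite /stalk_idem; case: ifP => _; rewrite ?mulr0. Qed.

Lemma stalk_idem_n : stalk_idem (n + 1) = e.
Proof. by rewrite /stalk_idem eqxx. Qed.

Notation Ae := (fun i : int => lideal_mod (stalk_idem i)).

Lemma stalk_valE (i : int) (y : Ae i) : vsval y * stalk_idem i = vsval y.
Proof. by apply/eqP; rewrite -lidealP ?stalk_idem_idem ?subvsP. Qed.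

Lemma stalk_val_n (y : Ae (n + 1)) : vsval y * e = vsval y.
Proof.
have <- : vsval y * stalk_idem (n + 1) = vsval y * e.
  by congr (_ * _); apply: stalk_idem_n.
exact: stalk_valE.
Qed.

Lemma stalk_eq0 (i : int) (y : Ae i) : i != n + 1 -> y = 0.
Proof.
move=> /negPf ne; apply: val_inj; rewrite [RHS]vsval0.
have : vsval y * stalk_idem i = vsval y * 0.
  by congr (_ * _); rewrite /stalk_idem ne.
by rewrite mulr0 stalk_valE.
Qed.

Fact stalk_diff_hom (i : int) : modhom (0 : 'Hom(Ae i, Ae (i + 1))).
Proof. exact: modhom0. Qed.

Fact stalk_diffK (i : int) x :
  (0 : 'Hom(Ae (i + 1), Ae (i + 1 + 1))) ((0 : 'Hom(Ae i, Ae (i + 1))) x) = 0.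
Proof. by rewrite !zero_lfunE. Qed.

Fact stalk_bounded : exists m : nat, forall i : int,
  (m < `|i|)%N -> \dim (fullv : {vspace Ae i}) = 0%N.
Proof.
exists (absz (n + 1)) => i ni; apply/dim0P => y; apply: stalk_eq0.
by apply: contraTneq ni => ->; rewrite ltnn.
Qed.

Definition stalk : cplx A := Cplx stalk_diff_hom stalk_diffK stalk_bounded.

Lemma stalk_diffE (i : int) x : cdiff stalk i x = 0.
Proof. exact: zero_lfunE. Qed.

Definition stalk_gen : stalk (n + 1) := vsproj (lideal (stalk_idem (n + 1))) e.

Lemma stalk_genE : vsval stalk_gen = e.
Proof. by rewrite vsprojK // lidealP ?stalk_idem_idem // stalk_idem_n ee. Qed.

Lemma stalk_gen_act (y : stalk (n + 1)) : y = mact _ (vsval y) stalk_gen.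
Proof. by apply: val_inj; rewrite [RHS]lideal_actE stalk_genE [RHS]stalk_val_n. Qed.

(** A map out of A e is determined by its value at e: if the difference of f and g
    sends e to d w, then y |-> y w is a homotopy between them. *)
Lemma stalk_homotopic (Z : cplx A) (f g : cmap stalk Z) :
  cohomologous (f (n + 1) stalk_gen) (g (n + 1) stalk_gen) -> homotopic f g.
Proof.
move=> [w ew]; pose wz := @dfwith _ (fun i : int => (Z i : Type)) (fun=> 0) n w.
pose h (i : int) : 'Hom(stalk (i + 1), Z i) :=
  linfun (fun y : stalk (i + 1) => mact (Z i) (vsval y) (wz i)).
have hE (i : int) y : h i y = mact (Z i) (vsval y) (wz i).
  by rewrite /h linfunK // => c u v; rewrite !linearP add_lfunE scale_lfunE.
exists h => [i a y|i y].
  by rewrite !hE lideal_actE mactM comp_lfunE.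
rewrite stalk_diffE homf0 addr0 hE.
have [ein|ne] := eqVneq n i; last first.
  rewrite (@stalk_eq0 (i + 1) y) ?homf0 ?subrr; last first.
    by apply: contraNneq ne => /addIr ->.
  by rewrite vsval0 linear0 zero_lfunE homf0.
case: i / ein y => y; rewrite /wz dfwith_in cdiff_hom -ew homfB.
by rewrite -(cfun_hom f) -(cfun_hom g) -stalk_gen_act.
Qed.

Definition rmul_fun (x : A) (i : int) : 'Hom(stalk i, stalk i) :=
  linfun (fun y : stalk i => vsproj (lideal (stalk_idem i)) (vsval y * x * stalk_idem i)).

Lemma rmul_funE x i y : vsval (rmul_fun x i y) = vsval y * x * stalk_idem i.
Proof.
rewrite /rmul_fun linfunK; last first.
  by move=> c u v; rewrite linearP /= !mulrDl -!scalerAl linearP.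
by rewrite vsprojK // lidealP ?stalk_idem_idem // -mulrA stalk_idem_idem.
Qed.

Fact rmul_hom x (i : int) : modhom (rmul_fun x i).
Proof.
move=> a y; apply: val_inj.
by rewrite [LHS]rmul_funE [RHS]lideal_actE rmul_funE lideal_actE !mulrA.
Qed.

Fact rmulD x (i : int) y :
  rmul_fun x (i + 1) (cdiff stalk i y) = cdiff stalk i (rmul_fun x i y).
Proof. by rewrite !stalk_diffE homf0. Qed.

Definition rmul x : cmap stalk stalk := CMap (@rmul_hom x) (@rmulD x).

Lemma rmulE x i y : vsval (rmul x i y) = vsval y * x * stalk_idem i.
Proof. exact: rmul_funE. Qed.

Lemma rmul_gen x : vsval (rmul x (n + 1) stalk_gen) = e * x * e.
Proof. by rewrite rmulE stalk_genE stalk_idem_n. Qed.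

Lemma rmulM x y (i : int) z : x * e = x ->
  rmul (x * y) i z = rmul y i (rmul x i z).
Proof.
move=> xe; apply: val_inj; rewrite [LHS]rmulE [RHS]rmulE rmulE -!mulrA.
congr (_ * _); rewrite /stalk_idem; case: ifP => _; rewrite ?mulr0 //.
by rewrite [RHS]mulrA xe.
Qed.

(** In the cohomology of the middle complex the value of c at e is the class of
    some y in A e, and e y is then the required element of e A e. *)
Lemma stalk_frac_full (c : Defs.frac stalk stalk) :
  exists x, [/\ e * x = x, x * e = x & frac_eq (frac_of (rmul x)) c].
Proof.
have [y _ cy] := frac_coh_total c (stalk_diffE stalk_gen).
exists (e * vsval y); split; first by rewrite mulrA ee.
  by rewrite -mulrA stalk_val_n.
exists (fmid c), (fden c), (cmap_id _); split.
- exact: qis_comp (fden_qis c) (qis_id _).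
- by apply: homotopic_ext => i x; rewrite !cmap_compE /= !id_lfunE.
apply: stalk_homotopic; rewrite !cmap_compE id_lfunE.
have eg : mact (stalk (n + 1)) e stalk_gen = stalk_gen.
  by rewrite [RHS]stalk_gen_act stalk_genE.
have -> : rmul (e * vsval y) (n + 1) stalk_gen = mact _ e y.
  apply: val_inj; rewrite [LHS]rmul_gen [RHS]lideal_actE.
  by rewrite mulrA ee -mulrA stalk_val_n.
rewrite (cfun_hom (fden c)) -[in X in cohomologous _ X]eg (cfun_hom (fnum c)).
exact/coh_act/coh_sym.
Qed.

Lemma stalk_frac_ext1 (c : Defs.frac stalk (cshift stalk)) :
  frac_eq c (frac_scale 0 c).
Proof.
case: c => Z num den qden; apply: frac_eq_num; apply: stalk_homotopic.
rewrite scale_lfunE scale0r.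
have [y _] := frac_coh_total (Frac num qden) (stalk_diffE stalk_gen).
have -> : y = 0 by apply: (@stalk_eq0 (n + 1 + 1)); lia.
by rewrite /frac_coh homf0.
Qed.

Lemma rmul_frac_faithful x : e * x = x -> x * e = x ->
  frac_eq (frac_of (rmul x)) (frac_scale 0 (frac_of (rmul x))) -> x = 0.
Proof.
move=> ex xe c0.
have [w] := frac_coh_eq (stalk_diffE _) (stalk_diffE _) c0 (frac_coh_of (rmul x) stalk_gen).
rewrite [RHS]stalk_diffE /= scale_lfunE scale0r id_lfunE sub0r => /eqP.
rewrite oppr_eq0 => /eqP/(congr1 vsval); rewrite vsval0 rmul_gen.
by rewrite ex xe.
Qed.

End Stalk.

(** * Isomorphisms of the derived category *)

Section FracIso.
Variables (k : fieldType) (A : falgType k).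
Implicit Types X Y : cplx A.

(** The two comparisons have the middle complex of b in common; their homotopy
    pushout dominates both. *)
Lemma frac_eq_trans X Y (a b c : Defs.frac X Y) :
  frac_eq a b -> frac_eq b c -> frac_eq a c.
Proof.
move=> [W [u [v [qu den num]]]] [W' [u' [v' [qu' den' num']]]].
have qv : qis v by apply: (qis_cancel (fden_qis b)); apply: qis_homotopic den qu.
have := hopush_comm v u'; have := qis_hopush_inr u' qv.
move: (hopush_inl v u') (hopush_inr v u') => inl inr qinr comm.
have key Z (x : cmap Z (fmid a)) (y : cmap Z (fmid b)) (z : cmap Z (fmid c)) :
    homotopic (cmap_comp u x) (cmap_comp v y) ->
    homotopic (cmap_comp u' y) (cmap_comp v' z) ->
  homotopic (cmap_comp (cmap_comp inl u) x) (cmap_comp (cmap_comp inr v') z).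
  move=> h1 h2; apply: homotopic_trans (homotopicA _ _ _) _.
  apply: homotopic_trans (homotopic_compl _ h1) _.
  apply: homotopic_trans (homotopic_sym (homotopicA _ _ _)) _.
  apply: homotopic_trans (homotopic_compr _ comm) _.
  apply: homotopic_trans (homotopicA _ _ _) _.
  apply: homotopic_trans (homotopic_compl _ h2) _.
  exact/homotopic_sym/homotopicA.
exists (hopush v u'), (cmap_comp inl u), (cmap_comp inr v').
split; [|exact: key den den'|exact: key num num'].
apply: qis_homotopic (homotopic_sym (key _ _ _ _ den den')) _.
apply: qis_homotopic (homotopic_sym (homotopicA _ _ _)) _.
exact: qis_comp qinr (qis_homotopic den' qu').
Qed.

Lemma frac_coh_id X (i : int) (x y : X (i + 1)) :
  frac_coh (frac_id X) x y -> cohomologous x y.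
Proof. by rewrite /frac_coh /= !id_lfunE. Qed.

(** An isomorphism acts bijectively on cohomology, and so does its denominator. *)
Lemma tiso_qis_num (X Y : Db A) (a : thom X Y) : tiso a -> qis (fnum a).
Proof.
move=> [b [ba ab]]; apply: qis_of_coh => i.
  move=> x dx ax0; apply: frac_coh_id.
  apply: frac_coh_eq ba _; rewrite ?homf0 //.
  apply: (@frac_coh_comp _ _ i X Y X a b x 0 0); rewrite /frac_coh ?homf0 //.
  exact: coh_refl.
move=> z dz; have [y dy zy] := qis_surj (fden_qis a) dz.
have [x dx yx] := frac_coh_total b dy.
have [y' dy' xy'] := frac_coh_total a dx.
exists x => //; apply: (coh_trans zy); apply: coh_trans _ (coh_sym xy').
apply: coh_map; apply: frac_coh_id; apply: frac_coh_eq ab _ => //.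
exact: frac_coh_comp dx yx xy'.
Qed.

End FracIso.

(** * Transport along a derived equivalence to a hereditary algebra *)

Section Transport.
Variables (k : closedFieldType) (A H : falgType k) (e : A).
Hypothesis prim : primitive_idempotent e.
Hypothesis her : hereditary H.
Variable E : tri_equivalence (Db A) (Db H).

Fact prim_idem : e * e = e. Proof. by case: prim. Qed.

Notation S := (stalk 0 prim_idem).
Let X : cplx H := eob E (S : Db A).
Notation P := (cocycle_cover X).
Notation pi := (@cover_map _ _ X).
Notation R := (@cobound_cover _ _ X).

Definition endo (x : A) : Defs.frac X X :=
  emor E (frac_of (rmul 0 prim_idem x) : @thom _ (Db A) S S).

(** The endomorphism of X that corresponds to x acts on H^(i+1)(X) as G does on
    P (i + 1) / R i. *)
Definition represents (i : int) (x : A) (G : 'End(P (i + 1))) :=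
  forall p, frac_coh (endo x) (pi (i + 1) p) (pi (i + 1) (G p)).

Lemma coh_eq_endo (i : int) (a b : Defs.frac X X) p q :
  frac_eq a b -> frac_coh a (pi (i + 1) p) (pi (i + 1) q) ->
  frac_coh b (pi (i + 1) p) (pi (i + 1) q).
Proof. by apply: frac_coh_eq; apply: cover_map_cycle. Qed.

Lemma represents_mul (i : int) x y (F G : 'End(P (i + 1))) :
  x * e = x -> represents x F -> represents y G -> represents (x * y) (G \o F)%VF.
Proof.
move=> xe rF rG p; rewrite comp_lfunE.
have xy : frac_eq (endo (x * y)) (frac_comp (endo y) (endo x)).
  apply: frac_eq_trans (emor_comp E _ _); apply: (emor_eq E).
  by apply: frac_of_comp => j z; apply: rmulM.
apply: coh_eq_endo (frac_eq_sym xy) _.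
exact: frac_coh_comp (cover_map_cycle _) (rF p) (rG _).
Qed.

Lemma represents_scalar (i : int) c :
  represents (c *: e) (c *: \1%VF : 'End(P (i + 1))).
Proof.
move=> p; rewrite scale_lfunE id_lfunE homfZ.
have ce : frac_eq (endo (c *: e)) (emor E (tscale c (tid (S : Db A)))).
  apply: (emor_eq E); apply: frac_eq_num; apply: homotopic_ext => j z.
  apply: val_inj; rewrite [LHS]rmulE scale_lfunE id_lfunE [RHS]linearZ /=.
  rewrite -scalerAr -scalerAl; congr (_ *: _).
  have ej : e * stalk_idem e 0 (j + 1) = stalk_idem e 0 (j + 1).
    by rewrite /stalk_idem; case: ifP => _; rewrite ?mulr0 ?prim_idem.
  by rewrite -[LHS]mulrA ej stalk_valE ?prim_idem.
have cid := frac_eq_trans ce (emor_scale E c (tid (S : Db A))).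
rewrite -homfZ; apply: coh_eq_endo (frac_eq_sym cid) _; rewrite homfZ.
apply: frac_coh_scale; apply: coh_eq_endo (frac_eq_sym (emor_id E (S : Db A))) _.
by rewrite /frac_coh /= id_lfunE; apply: coh_refl.
Qed.

Lemma represents_add (i : int) x y (F G : 'End(P (i + 1))) :
  represents x F -> represents y G -> represents (x + y) (F + G).
Proof.
move=> rF rG p; rewrite add_lfunE.
have xy : frac_eq (endo (x + y)) (frac_add (endo x) (endo y)).
  apply: frac_eq_trans (emor_add E _ _); apply: (emor_eq E).
  apply: frac_of_add => j z; apply: val_inj.
  by rewrite [LHS]rmulE [RHS]linearD /= !rmul_funE mulrDr mulrDl.
apply: coh_eq_endo (frac_eq_sym xy) _; rewrite homfD.
exact: frac_coh_add (cover_map_cycle _) (rF p) (rG p).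
Qed.

Lemma represents_uniq (i : int) x (F G : 'End(P (i + 1))) p :
  represents x F -> represents x G -> F p - G p \in R i.
Proof.
move=> rF rG; apply/cobound_cover_coh.
by apply: frac_coh_uniq (rF p) (rG p); apply: cover_map_cycle.
Qed.

Lemma represents_nilpotent (i : int) x m (F : 'End(P (i + 1))) :
  x * e = x -> x ^+ m.+1 = 0 -> represents x F -> forall p, iter m.+1 F p \in R i.
Proof.
move=> xe xm rF p.
have [G rG GE] : exists2 G : 'End(P (i + 1)), represents (x ^+ m.+1) G &
    forall q, G q = iter m.+1 F q.
  elim: m {xm} => [|m [G rG GE]]; first by exists F.
  exists (F \o G)%VF => [|q]; last by rewrite comp_lfunE GE.
  by rewrite exprSr; apply: represents_mul => //; rewrite exprSr -mulrA xe.
rewrite -GE -[G p]subr0; have <- : (0 *: \1%VF : 'End(P (i + 1))) p = 0.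
  by rewrite scale0r zero_lfunE.
by apply: (represents_uniq _ rG); rewrite xm -(scale0r e); apply: represents_scalar.
Qed.

(** An endomorphism of X comes from an element of e A e, which is a scalar up to
    a nilpotent. The scalar belongs to the endomorphism, so it is the same in all
    cohomological degrees. *)
Lemma endo_local (a : Defs.frac X X) : exists c m, forall (i : int) (G : 'End(P (i + 1))),
    (forall p, frac_coh a (pi (i + 1) p) (pi (i + 1) (G p))) ->
  forall p, iter m (G - c *: \1%VF : 'End(P (i + 1))) p \in R i.
Proof.
have [f fa] := @efull _ _ _ E (S : Db A) (S : Db A) a.
have [x [ex xe xf]] := stalk_frac_full f.
have xa : frac_eq (endo x) a := frac_eq_trans (emor_eq E xf) fa.
have [c [m xm]] := corner_eigenvalue prim ex xe.
exists c, m.+1 => i G aG p.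
apply: represents_nilpotent xm _ _.
  by rewrite mulrBl xe -scalerAl prim_idem.
rewrite -!scaleNr; apply: represents_add; last exact: represents_scalar.
by move=> q; apply: coh_eq_endo (frac_eq_sym xa) _.
Qed.

(** Were the cohomology nonzero in two degrees, the projection onto one of them
    would be an endomorphism of X with eigenvalue 1 in that degree and 0 in the
    other. *)
Lemma single_degree : exists n : int, forall i : int, i != n -> forall p, p \in R i.
Proof.
have [s qs sE] := reso_qis X her; apply: Classical_Prop.NNPP => nfull.
have not_full (n : int) : exists i : int, i != n /\ exists p, p \notin R i.
  apply: Classical_Prop.NNPP => hn; apply: nfull; exists n => i ne p.
  by apply/negPn/negP => pR; apply: hn; exists i; split=> //; exists p.
have [i [_ [p pR]]] := not_full 0; have [j [ji [q qR]]] := not_full i.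
pose G (l : int) : 'End(P l) := (l == i + 1)%:R *: \1%VF.
have [||a aG] := frac_coh_realize qs sE (G := G).
- by move=> l; apply/modhomZ/modhom1.
- by move=> l x xR; rewrite scale_lfunE id_lfunE memvZ.
have [c [m cm]] := endo_local a.
have := cm i (G (i + 1)) (aG i) p; have := cm j (G (j + 1)) (aG j) q.
rewrite /G eqxx -!scalerBl !iter_scalar !rpredZeq (negPf pR) (negPf qR) !orbF.
have -> : (j + 1 == i + 1) = false by apply: contraNF ji => /eqP/addIr ->.
rewrite sub0r !expf_eq0 oppr_eq0 => /andP[_ /eqP ->].
by rewrite subr0 oner_eq0 andbF.
Qed.

(** The image of x in the endomorphisms of the cohomology of X is nilpotent, hence
    zero by rigid_nilpotent_eq0; faithfulness on both sides of the equivalence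
    then gives x = 0. *)
Lemma corner_nilpotent_eq0 (x : A) m :
  e * x = x -> x * e = x -> x ^+ m.+1 = 0 -> x = 0.
Proof.
move=> ex xe xm; have [s qs sE] := reso_qis X her; have [n fullR] := single_degree.
(* The Ext^1 lemma is stated two degrees above its index. *)
have [j en] : exists j : int, n = j + 1 by exists (n - 1); rewrite subrK.
move: fullR; rewrite en => fullR.
have [F hF rF] := frac_coh_lift (j + 1) (endo x).
have FR : forall p, F p \in R (j + 1).
  apply: (rigid_nilpotent_eq0 (stR := @cobound_cover_stable _ _ X (j + 1)) her
            (cover_projective (i := _)) _ _ hF (frac_coh_cobound rF)
            (represents_nilpotent xe xm rF)) => [phi hphi|G hG GR].
    apply: (frac_ext1 qs (Y := eob E (cshift S : Db A)) (e := eshift E (S : Db A))) => //.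
      exact: tiso_qis_num (eshift_iso E _).
    move=> a; have [f fa] := @efull _ _ _ E (S : Db A) (cshift S : Db A) a.
    exists (emor E f).
    apply: frac_eq_trans (frac_eq_sym fa) _.
    apply: frac_eq_trans (emor_scale E 0 f).
    by apply: (emor_eq E); apply: stalk_frac_ext1.
  have [a aG] := frac_coh_realize1 qs sE hG GR; have [c [l cl]] := endo_local a.
  by exists c, l; apply: cl.
apply: (rmul_frac_faithful (n := 0) (ee := prim_idem)) => //.
apply: (@efaithful _ _ _ E (S : Db A) (S : Db A)).
apply: (frac_coh_faithful qs sE fullR) => p; exists 0; split.
  have := FR p; rewrite -[F p]subr0 cobound_cover_coh => Fp0.
  exact: coh_trans (rF p) (coh_map (fden (endo x)) Fp0).
apply: coh_eq_endo (frac_eq_sym (emor_scale E 0 _)) _.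
by have := frac_coh_scale 0 (rF p); rewrite scale0r homf0.
Qed.

End Transport.

Theorem lemma5p2 (k : closedFieldType) (A : falgType k)
    (A_basic : basic A) (A_connected : connected A)
    (A_pwh : piecewise_hereditary A) :
  no_nonzero_oriented_cycles A.
Proof.
case: A_pwh => H [_ _ her [E]] e prim; have [e0 ee _] := prim.
pose f : 'Hom(k^o, A) := linfun (fun c : k^o => c *: e).
have fE c : f c = c *: e.
  by apply: linfunK => d x y; rewrite scalerDl scalerA.
exists (f : {linear k^o -> A}); split=> /= [|x y|x y|a].
- by rewrite fE scale1r.
- by rewrite !fE -scalerAl -scalerAr ee scalerA.
- move=> /eqP; rewrite !fE -subr_eq0 -scalerBl scaler_eq0 (negPf e0) orbF.
  by rewrite subr_eq0 => /eqP.
split=> [|[c <-]]; last first.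
  have : e * 1 * e \in corner e by rewrite /corner !memv_mul ?memv_line ?memvf.
  by rewrite mulr1 ee fE; apply: memvZ.
move=> aC; have [ea ae] := cornerP ee aC; have [c [m am]] := corner_eigenvalue prim ea ae.
exists c; rewrite fE; apply/esym/eqP; rewrite -subr_eq0; apply/eqP.
apply: (corner_nilpotent_eq0 prim her E _ _ am).
  by rewrite mulrBr ea -scalerAr ee.
by rewrite mulrBl ae -scalerAl ee.
Qed.
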